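(* Let $d \in \{1,2,\ldots\}$, let $n_1,n_2 \geq 1$ be integers with $n = n_1 + n_2$, and let $b_1,b_2 \in (0,\infty)$. Let $\mathfrak{X}^{(1)}_1,\ldots,\mathfrak{X}^{(1)}_{n_1}$ and $\mathfrak{X}^{(2)}_1,\ldots,\mathfrak{X}^{(2)}_{n_2}$ be two independent random samples (each iid) of $\mathcal{S}_{++}^d$-valued random matrices with respective densities $f^{(1)}$ and $f^{(2)}$ supported on $\mathcal{S}_{++}^d$, and let $T(n_1,n_2)$ be the statistic defined in the context. For $i,\ell \in \{1,2\}$, let $\delta_{i,\ell} = 1$ if $i = \ell$ and $\delta_{i,\ell} = 0$ if $i \neq \ell$, and let $a_{i,\ell} = \delta_{i,\ell} - n_\ell/n$. Then, with $r = d(d+1)/2$, $$ \begin{aligned} T(n_1,n_2) &= \frac{1}{2^{r}} \sum_{i=1}^2 n_i \sum_{\ell_1=1}^2 \sum_{\ell_2=1}^2 \frac{a_{i,\ell_1} a_{i,\ell_2}}{n_{\ell_1} n_{\ell_2}} \, b_{\ell_1}^{-d/(2 b_{\ell_1}) - r} \, b_{\ell_2}^{-d/(2 b_{\ell_2}) - r} \, \frac{\Gamma_d\left(\frac{1}{2 b_{\ell_1}} + \frac{1}{2 b_{\ell_2}} + \frac{d+1}{2}\right)}{\Gamma_d\left(\frac{1}{2 b_{\ell_1}} + \frac{d+1}{2}\right) \Gamma_d\left(\frac{1}{2 b_{\ell_2}} + \frac{d+1}{2}\right)} \\ &\qquad \times \sum_{i_1=1}^{n_{\ell_1}} \sum_{i_2=1}^{n_{\ell_2}}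 \frac{|\mathfrak{X}_{i_1}^{(\ell_1)}|^{1/(2 b_{\ell_1})} \, |\mathfrak{X}_{i_2}^{(\ell_2)}|^{1/(2 b_{\ell_2})}}{\left|b_{\ell_1}^{-1} \mathfrak{X}_{i_1}^{(\ell_1)} + b_{\ell_2}^{-1} \mathfrak{X}_{i_2}^{(\ell_2)}\right|^{1/(2 b_{\ell_1}) + 1/(2 b_{\ell_2}) + (d+1)/2}}. \end{aligned} $$
   Context: $\mathcal{S}^d$ is the space of $d\times d$ real symmetric matrices and $\mathcal{S}_{++}^d$ is the cone of symmetric positive definite $d \times d$ matrices. Integration over these sets is with respect to coordinate Lebesgue measure $dX = \prod_{1\leq i\leq j\leq d} dX_{ij}$, and densities are with respect to this measure. $|\cdot|$ is the determinant, $\mathrm{tr}$ the trace, and $\mathrm{etr}(\cdot) = \exp\{\mathrm{tr}(\cdot)\}$. The multivariate gamma function is $$\Gamma_d(\alpha) = \int_{\mathcal{S}_{++}^d} \mathrm{etr}(-X)\,|X|^{\alpha-(d+1)/2}\,dX = \pi^{d(d-1)/4}\prod_{i=1}^d \Gamma(\alpha-(i-1)/2), \qquad \Re(\alpha) > (d-1)/2.$$ For $\nu > d-1$ and $\Sigma \in \mathcal{S}_{++}^d$, the Wishart density is $$K_{\nu,\Sigma}(X) = \frac{|X|^{\nu/2-(d+1)/2}\,\mathrm{etr}(-\Sigma^{-1}X/2)}{|2\Sigma|^{\nu/2}\,\Gamma_d(\nu/2)}, \qquad X\in\mathcal{S}_{++}^d.$$ For $b > 0$ put $\nu(b,d) =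 1/b + d + 1$. For $\ell \in \{1,2\}$, the Wishart kernel density estimator of $f^{(\ell)}$ is $$\hat f^{(\ell)}_{n_\ell,b_\ell}(S) = \frac{1}{n_\ell}\sum_{i=1}^{n_\ell} K_{\nu(b_\ell,d),\,b_\ell S}(\mathfrak{X}^{(\ell)}_i), \qquad S \in \mathcal{S}_{++}^d,$$ and the test statistic is $$T(n_1,n_2) = \frac{n_1n_2}{n}\int_{\mathcal{S}_{++}^d}\left\{\hat f^{(1)}_{n_1,b_1}(S) - \hat f^{(2)}_{n_2,b_2}(S)\right\}^2 dS = \sum_{i=1}^2 n_i \int_{\mathcal{S}_{++}^d}\Big\{\hat f^{(i)}_{n_i,b_i}(S) - \sum_{\ell=1}^2 \frac{n_\ell}{n}\hat f^{(\ell)}_{n_\ell,b_\ell}(S)\Big\}^2 dS.$$ *)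

(* Defs.v *)
From HB Require Import structures.
From mathcomp Require Import all_boot all_order all_algebra.
From mathcomp Require Import all_classical all_reals all_analysis.

Set Implicit Arguments.
Unset Strict Implicit.
Unset Printing Implicit Defensive.

Import Order.TTheory GRing.Theory Num.Theory.
Import numFieldNormedType.Exports.

Local Open Scope classical_set_scope.
Local Open Scope ring_scope.

(* Matrices carry the product sigma-algebra, generated by the entries. *)
Definition measure_matrix_display : measure_display -> measure_display.
Proof. exact. Qed.

Section measurable_matrix.
Context {d : measure_display} {T : measurableType d}.
Variables m n : nat.

Definition entry_sets : set (set 'M[T]_(m, n)) :=
  \bigcup_(p in [set: 'I_m * 'I_n])
    preimage_set_system setT (fun M : 'M[T]_(m, n) => M p.1 p.2) measurable.

Let matrix_set0 : <<s entry_sets >> set0.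
Proof. exact: sigma_algebra0. Qed.

Let matrix_setC A : <<s entry_sets >> A -> <<s entry_sets >> (~` A).
Proof. exact: sigma_algebraC. Qed.

Let matrix_bigcup (F : (set 'M[T]_(m, n))^nat) :
  (forall i, <<s entry_sets >> (F i)) -> <<s entry_sets >> (\bigcup_i F i).
Proof. exact: sigma_algebra_bigcup. Qed.

HB.instance Definition _ := @isMeasurable.Build (measure_matrix_display d)
  'M[T]_(m, n) <<s entry_sets >> matrix_set0 matrix_setC matrix_bigcup.

End measurable_matrix.

Lemma measurable_fun_matrixP d d' (T1 : measurableType d)
    (T2 : measurableType d') m n (f : T1 -> 'M[T2]_(m, n)) :
  (forall i j, measurable_fun [set: T1] (fun x => f x i j)) ->
  measurable_fun [set: T1] f.
Proof.
move=> mf; apply: (@measurability _ _ _ _ _ _ (@entry_sets _ T2 m n)) => //.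
move=> _ [_ [[i j] _ [B mB <-]] <-] /=.
by rewrite !setTI -comp_preimage -[X in measurable X]setTI; exact: mf.
Qed.

Definition image_measure d d' (T1 : measurableType d) (T2 : measurableType d')
    (R : realType) (m : {measure set T1 -> \bar R}) (f : T1 -> T2)
    (mf : measurable_fun [set: T1] f) : {measure set T2 -> \bar R} :=
  measure_function_pushforward__canonical__measure_function_Measure m mf.

Section coordinate_lebesgue.
Variable R : realType.

Definition cons_pair k (p : k.-tuple R * R) : k.+1.-tuple R :=
  [tuple of p.2 :: p.1].

Lemma measurable_cons_pair k : measurable_fun [set: k.-tuple R * R] (@cons_pair k).
Proof. exact: measurable_cons. Qed.

(* Lebesgue measure on R^k, as an iterated product of the one on R. *)
Fixpoint lebesgue_tuple (k : nat) : {measure set (k.-tuple R) -> \bar R} :=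
  match k with
  | 0 => dirac ([tuple] : 0.-tuple R)
  | k'.+1 => image_measure (lebesgue_tuple k' \x @lebesgue_measure R)%E
               (@measurable_cons_pair k')
  end.

(* The positions (i, j) with i <= j, in lexicographic order. *)
Definition upper_pairs d : seq ('I_d * 'I_d) :=
  [seq p : 'I_d * 'I_d <- enum {: 'I_d * 'I_d} | (p.1 <= p.2)%N].

Definition sym_dim d : nat := (d * d.+1)./2.

Lemma size_upper_pairs d : size (upper_pairs d) = sym_dim d.
Proof.
rewrite size_filter -sum1_count big_enum_cond /=.
transitivity (\sum_(j < d) \sum_(i < d | (i <= j)%N) 1)%N.
  rewrite (exchange_big_dep xpredT)//= pair_big_dep/=.
  by apply: eq_bigl => -[i j].
under eq_bigr => j _ do
  rewrite -(big_ord_widen d (fun=> 1%N) (ltn_ord j)) sum1_card card_ord.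
rewrite /sym_dim mulnC -[RHS]bin2 -bin2_sum big_nat_recl//= add0n.
by rewrite big_mkord.
Qed.

(* The symmetric matrix whose entries X_ij, i <= j, are listed by t. *)
Definition sym_of_tuple d (t : (sym_dim d).-tuple R) : 'M[R]_d :=
  \matrix_(i, j) nth 0 t
    (index (if (i <= j)%N then (i, j) else (j, i)) (upper_pairs d)).

Lemma measurable_sym_of_tuple d :
  measurable_fun [set: (sym_dim d).-tuple R] (@sym_of_tuple d).
Proof.
apply: measurable_fun_matrixP => i j.
set p := if (i <= j)%N then (i, j) else (j, i).
have p_lt : (index p (upper_pairs d) < sym_dim d)%N.
  rewrite -size_upper_pairs index_mem mem_filter mem_enum andbT /p.
  by case: ifPn => //=; rewrite -ltnNge; exact: ltnW.
rewrite (_ : (fun _ => _) = @tnth _ R ^~ (Ordinal p_lt)).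
  exact: measurable_tnth.
by apply/funext => t; rewrite mxE (tnth_nth 0).
Qed.

(* The measure dX = \prod_(i <= j) dX_ij, carried by the symmetric matrices. *)
Definition lebesgue_sym d : {measure set 'M[R]_d -> \bar R} :=
  image_measure (lebesgue_tuple (sym_dim d)) (@measurable_sym_of_tuple d).

End coordinate_lebesgue.

Section wishart.
Variables (R : realType) (d : nat).
Implicit Types (X S Sigma : 'M[R]_d).

Definition posdef : set 'M[R]_d :=
  [set X | X^T = X /\
     forall u : 'cV[R]_d, u != 0 -> 0 < (u^T *m X *m u) 0 0].

Definition etr X : R := expR (\tr X).

(* Meaningful for alpha > (d - 1) / 2, where the integral is finite. *)
Definition mgamma (alpha : R) : R :=
  (\int[@lebesgue_sym R d]_(X in posdef)
     (etr (- X) * \det X `^ (alpha - d.+1%:R / 2)))%R.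

Definition wishart_density (nu : R) Sigma X : R :=
  \det X `^ (nu / 2 - d.+1%:R / 2) * etr (- (2^-1 *: (invmx Sigma *m X))) /
  (\det (2 *: Sigma) `^ (nu / 2) * mgamma (nu / 2)).

Definition wishart_kde n (b : R) (x : 'I_n -> 'M[R]_d) S : R :=
  n%:R^-1 * \sum_(i < n) wishart_density (b^-1 + d%:R + 1) (b *: S) (x i).

(* Extended-real-valued, as the integral of a nonnegative function. *)
Definition test_statistic n1 n2 (b1 b2 : R)
    (x1 : 'I_n1 -> 'M[R]_d) (x2 : 'I_n2 -> 'M[R]_d) : \bar R :=
  (((n1 * n2)%:R / (n1 + n2)%:R)%:E *
   \int[@lebesgue_sym R d]_(S in posdef)
     ((wishart_kde b1 x1 S - wishart_kde b2 x2 S) ^+ 2)%:E)%E.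

End wishart.

Section samples.
Context d0 d1 (Omega : measurableType d0) (T : measurableType d1)
  (R : realType) (P : probability Omega R).

Definition mutually_independent (I : finType) (X : I -> {RV P >-> T}) : Prop :=
  forall (J : {set I}) (A : I -> set T),
    (forall i, i \in J -> measurable (A i)) ->
    P (\bigcap_(i in [set` J]) (X i @^-1` A i)) =
    (\prod_(i in J) P (X i @^-1` A i))%E.

End samples.

Definition density_on_posdef d0 (Omega : measurableType d0) (R : realType)
    (P : probability Omega R) d (X : {RV P >-> 'M[R]_d}) (f : 'M[R]_d -> R) :
  Prop :=
  [/\ measurable_fun [set: 'M[R]_d] f,
      forall S, 0 <= f S,
      forall S, ~ posdef S -> f S = 0 &
      forall A, measurable A ->
        distribution P X A = (\int[@lebesgue_sym R d]_(S in A) (f S)%:E)%E].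

(* Main.v *)
Require Import Defs.
From HB Require Import structures.
From mathcomp Require Import all_boot all_order all_algebra.
From mathcomp Require Import all_classical all_reals all_analysis.
From mathcomp Require Import measurable_realfun ring lra.

(** Expanding the square in the statistic reduces the claim to the integral over
    S of a product of two kernels, that is, of
    [|S|^(-(g+d+1)) etr(-S^-1 M)] with [g = 1/(2 b1) + 1/(2 b2)].  It has to be
    matched with [|M|^(-(g+(d+1)/2)) Gamma_d(g+(d+1)/2)], where [Gamma_d] is the
    integral of [|Y|^g etr(-Y)].

    Instead of changing variables by [S = Y^-1] and by congruence, which would need
    Jacobians on the space of symmetric matrices, both integrals are computed by
    the same recursion on the dimension.  Write [M = [m, p^T; p, Q + p p^T / m]].
    For the integral in S put [S = [a, v^T; v, C + v v^T / a]], for the one in Y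
    put [Y = [a + v^T D^-1 v, v^T; v, D]]: these only translate Lebesgue measure.
    In both cases the integrand is Gaussian in [v], the integral in
    [a] is [m^(-(g+1)) Gamma(g+1)] (for S after the one-dimensional inversion
    [a -> m / a]), and what remains is the same integral in dimension [d - 1] with
    [M] replaced by the Schur complement [Q] and [g] replaced by [g + 1/2].  Hence
    both equal [|M|^(-(g+(d+1)/2))] times the same constant. *)

Set Implicit Arguments.
Unset Strict Implicit.
Unset Printing Implicit Defensive.

Import Order.TTheory GRing.Theory Num.Theory.
Import numFieldNormedType.Exports.

Local Open Scope classical_set_scope.
Local Open Scope ring_scope.

(** * Coordinate Lebesgue measure *)

Lemma sigma_finite_image_measure d1 d2 (T1 : measurableType d1)
    (T2 : measurableType d2) (R : realType) (m : {measure set T1 -> \bar R})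
    (f : T1 -> T2) (mf : measurable_fun [set: T1] f) (g : T2 -> T1) :
  measurable_fun [set: T2] g -> cancel f g ->
  sigma_finite [set: T1] m -> sigma_finite [set: T2] (image_measure m mf).
Proof.
move=> mg fK [F TF Foo]; exists (fun n => g @^-1` (F n)).
  by rewrite -preimage_bigcup -TF preimage_setT.
move=> n; have [mF Fn] := Foo n; split.
  by rewrite -[X in measurable X]setTI; exact: mg.
rewrite /image_measure /= /pushforward -comp_preimage.
by rewrite (_ : g \o f = id) //; apply/funext.
Qed.

Lemma sigma_finite_product d1 d2 (T1 : measurableType d1)
    (T2 : measurableType d2) (R : realType) (m1 : {measure set T1 -> \bar R})
    (m2 : {sigma_finite_measure set T2 -> \bar R}) :
  sigma_finite [set: T1] m1 -> sigma_finite [set: T1 * T2] (m1 \x m2)%E.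
Proof.
move=> /sigma_finiteP[F [TF ndF Foo]].
have /sigma_finiteP[G [TG ndG Goo]] := sigma_finiteT m2.
exists (fun n => F n `*` G n) => [|k].
  apply/seteqP; split=> -[x y] //= _.
  have [n _ Fnx] : (\bigcup_n F n) x by rewrite -TF.
  have [p _ Gpy] : (\bigcup_n G n) y by rewrite -TG.
  exists (maxn n p) => //; split.
    by move: x Fnx; exact/subsetPset/ndF/leq_maxl.
  by move: y Gpy; exact/subsetPset/ndG/leq_maxr.
have [[mF Fk] [mG Gk]] := (Foo k, Goo k).
split; first exact: measurableX.
by rewrite product_measure1E// lte_mul_pinfty// ge0_fin_numE.
Qed.

Lemma sigma_finite_lebesgue_tuple (R : realType) k :
  sigma_finite [set: k.-tuple R] (lebesgue_tuple R k).
Proof.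
elim: k => [|k IH] /=.
  by apply: fin_num_fun_sigma_finite => [|A mA]; rewrite ?measure0// fin_num_measure.
have sf := @sigma_finite_product _ _ _ _ _ _ (@lebesgue_measure R) IH.
refine (@sigma_finite_image_measure _ _ (k.-tuple R * measurableTypeR R)%type
  (k.+1.-tuple R) R _ _ (@measurable_cons_pair R k)
  (fun t : k.+1.-tuple R => ([tuple of behead t], thead t)) _ _ sf).
  apply/measurable_fun_pairP; split; first exact: measurable_behead.
  exact: measurable_tnth.
by move=> [t x]; congr pair; apply: val_inj.
Qed.

(** A named head on which sigma-finiteness is registered, so that Tonelli's theorem applies to the
    iterated measure. [lsym] plays the same role for symmetric matrices. *)
Definition leb (R : realType) k : set (k.-tuple R) -> \bar R :=
  lebesgue_tuple R k.
Arguments leb : clear implicits.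
HB.instance Definition _ R k := Measure.on (leb R k).
HB.instance Definition _ R k := Measure_isSigmaFinite.Build _ _ _ (leb R k)
  (@sigma_finite_lebesgue_tuple R k).

Definition lsym (R : realType) d : set 'M[R]_d -> \bar R := lebesgue_sym R d.
Arguments lsym : clear implicits.
HB.instance Definition _ R d := Measure.on (lsym R d).

Section tuple_measure.
Variable R : realType.
Local Open Scope ereal_scope.

Lemma integral_leb0 (f : 0.-tuple R -> \bar R) :
  measurable_fun [set: 0.-tuple R] f ->
  \int[leb R 0]_t f t = f [tuple].
Proof. by move=> mf; rewrite /leb /= integral_dirac// diracT mul1e. Qed.

Lemma integral_lebS k (f : k.+1.-tuple R -> \bar R) :
  measurable_fun [set: k.+1.-tuple R] f -> (forall t, 0 <= f t) ->
  \int[leb R k.+1]_t f t =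
  \int[lebesgue_measure]_x \int[leb R k]_t f [tuple of x :: t].
Proof.
move=> mf f0; rewrite /leb /=.
rewrite (@ge0_integral_pushforward _ _ (k.-tuple R * measurableTypeR R)%type
  (k.+1.-tuple R) _ _ (@measurable_cons_pair R k)
  (lebesgue_tuple R k \x @lebesgue_measure R) setT f)//.
rewrite preimage_setT.
have mfc : measurable_fun [set: k.-tuple R * R] (f \o @cons_pair R k).
  exact: measurableT_comp (@measurable_cons_pair R k).
(* [cons_pair] takes the head from the second factor, so the head is the outer variable. *)
by have := @fubini_tonelli2 _ _ (k.-tuple R) (measurableTypeR R) R
  (leb R k) (@lebesgue_measure R) _ mfc (fun=> f0 _).
Qed.

End tuple_measure.

Section translation.
Variable R : realType.
Local Open Scope ereal_scope.

(** The pushforward of Lebesgue measure by the translation agrees with Lebesgue measure on half-open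
    intervals, hence everywhere by uniqueness. *)
Lemma integral_lebesgue_shift (f : R -> \bar R) (c : R) :
  measurable_fun [set: R] f -> (forall x, 0 <= f x) ->
  \int[lebesgue_measure]_x f (x + c)%R = \int[lebesgue_measure]_x f x.
Proof.
move=> mf f0.
have ms : measurable_fun [set: measurableTypeR R]
    (fun x : measurableTypeR R => (x + c)%R : measurableTypeR R).
  exact: measurable_funD.
pose m := image_measure (@lebesgue_measure R) ms.
have mE A : measurable A -> @lebesgue_measure R A = m A.
  apply: lebesgue_measure_unique => _ [[a b] _ <-] /=.
  rewrite /m /image_measure /= /pushforward.
  rewrite (_ : _ @^-1` _ = `]a - c, b - c]%classic)%R; last first.
    by apply/seteqP; split=> x /=; rewrite !in_itv/= ltrBlDr lerBrDr.
  rewrite !lebesgue_measure_itv/= !lte_fin ltrD2r.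
  by case: ifPn => // _; rewrite -!EFinB; congr EFin; ring.
rewrite [RHS](@eq_measure_integral _ _ _ setT m).
  by rewrite (ge0_integral_pushforward ms)// ?preimage_setT// => x _.
by move=> A mA _; exact: (mE A mA).
Qed.

End translation.

(** * Measurability of matrix operations *)

Section measurable_matrix_operations.
Context d (T : measurableType d) (R : realType).

Lemma measurable_fun_coord m n (f : T -> 'M[R]_(m, n)) i j :
  measurable_fun [set: T] f -> measurable_fun [set: T] (fun x => f x i j).
Proof.
have mc : measurable_fun [set: 'M[R]_(m, n)] (fun M : 'M[R]_(m, n) => M i j).
  move=> _ B mB; apply: sub_sigma_algebra; exists (i, j) => //.
  by exists B.
by move=> mf; exact: (measurableT_comp mc mf).
Qed.

Lemma measurable_trmx m n (f : T -> 'M[R]_(m, n)) :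
  measurable_fun [set: T] f -> measurable_fun [set: T] (fun x => (f x)^T).
Proof.
move=> mf; apply: measurable_fun_matrixP => i j.
by under eq_fun do rewrite mxE; exact: measurable_fun_coord.
Qed.

Lemma measurable_addmx m n (f g : T -> 'M[R]_(m, n)) :
  measurable_fun [set: T] f -> measurable_fun [set: T] g ->
  measurable_fun [set: T] (fun x => f x + g x).
Proof.
move=> mf mg; apply: measurable_fun_matrixP => i j.
under eq_fun do rewrite mxE.
by apply: measurable_funD; exact: measurable_fun_coord.
Qed.

Lemma measurable_scalemx m n (a : T -> R) (f : T -> 'M[R]_(m, n)) :
  measurable_fun [set: T] a -> measurable_fun [set: T] f ->
  measurable_fun [set: T] (fun x => a x *: f x).
Proof.
move=> ma mf; apply: measurable_fun_matrixP => i j.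
under eq_fun do rewrite mxE.
by apply: measurable_funM => //; exact: measurable_fun_coord.
Qed.

Lemma measurable_oppmx m n (f : T -> 'M[R]_(m, n)) :
  measurable_fun [set: T] f -> measurable_fun [set: T] (fun x => - f x).
Proof.
move=> mf; under eq_fun do rewrite -scaleN1r.
by apply: measurable_scalemx => //; exact: measurable_cst.
Qed.

Lemma measurable_mulmx m n p (f : T -> 'M[R]_(m, n)) (g : T -> 'M[R]_(n, p)) :
  measurable_fun [set: T] f -> measurable_fun [set: T] g ->
  measurable_fun [set: T] (fun x => f x *m g x).
Proof.
move=> mf mg; apply: measurable_fun_matrixP => i j.
under eq_fun do rewrite mxE.
apply: measurable_sum => k.
by apply: measurable_funM; exact: measurable_fun_coord.
Qed.

Lemma measurable_mxtrace n (f : T -> 'M[R]_n) :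
  measurable_fun [set: T] f -> measurable_fun [set: T] (fun x => \tr (f x)).
Proof. by move=> mf; apply: measurable_sum => k; exact: measurable_fun_coord. Qed.

Lemma measurable_det n (f : T -> 'M[R]_n) :
  measurable_fun [set: T] f -> measurable_fun [set: T] (fun x => \det (f x)).
Proof.
move=> mf; apply: measurable_sum => s; apply: measurable_funM => //.
apply: measurable_prod => k _; exact: measurable_fun_coord.
Qed.

Lemma measurable_invr (a : T -> R) :
  measurable_fun [set: T] a -> measurable_fun [set: T] (fun x => (a x)^-1).
Proof.
move=> ma.
(* The power -1 is the inverse on nonnegative bases only, hence the square. At [a x = 0] both sides
   vanish because [0^-1 = 0]. *)
rewrite (_ : (fun _ => _) = fun x => a x * (a x ^+ 2) `^ (-1)); last first.
  apply/funext => x; rewrite powR_inv1 ?sqr_ge0// expr2 invfM mulrA.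
  have [->|ax0] := eqVneq (a x) 0; first by rewrite invr0 mulr0.
  by rewrite divff// mul1r.
apply: measurable_funM => //.
by apply: (measurableT_comp (measurable_powR _)); exact: measurable_funX.
Qed.

Lemma measurable_invmx n (f : T -> 'M[R]_n) :
  measurable_fun [set: T] f -> measurable_fun [set: T] (fun x => invmx (f x)).
Proof.
move=> mf; have mdet := measurable_det mf.
(* [invmx] is the adjugate formula where the determinant is nonzero and returns its argument
   elsewhere. Both branches are measurable, and so is the test. *)
rewrite /invmx; apply: measurable_fun_ifT => //.
  under eq_fun do rewrite unitmxE unitfE.
  rewrite (_ : (fun _ => _) = (fun x => ~~ (\det (f x) == cst 0 x))) //.
  by apply: measurable_neg; exact: measurable_fun_eqr.
apply: measurable_scalemx; first exact: measurable_invr.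
apply: measurable_fun_matrixP => i j.
under eq_fun do rewrite mxE.
apply: measurable_funM => //; apply: measurable_det.
apply: measurable_fun_matrixP => k l.
by under eq_fun do rewrite !mxE; exact: measurable_fun_coord.
Qed.

Lemma measurable_block_mx m1 m2 n1 n2 (f1 : T -> 'M[R]_(m1, n1))
    (f2 : T -> 'M[R]_(m1, n2)) (f3 : T -> 'M[R]_(m2, n1))
    (f4 : T -> 'M[R]_(m2, n2)) :
  measurable_fun [set: T] f1 -> measurable_fun [set: T] f2 ->
  measurable_fun [set: T] f3 -> measurable_fun [set: T] f4 ->
  measurable_fun [set: T] (fun x => block_mx (f1 x) (f2 x) (f3 x) (f4 x)).
Proof.
move=> mf1 mf2 mf3 mf4; apply: measurable_fun_matrixP => i j.
case: (split_ordP i) => k ->; case: (split_ordP j) => l ->.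
- by under eq_fun do rewrite block_mxEul; exact: measurable_fun_coord.
- by under eq_fun do rewrite block_mxEur; exact: measurable_fun_coord.
- by under eq_fun do rewrite block_mxEdl; exact: measurable_fun_coord.
- by under eq_fun do rewrite block_mxEdr; exact: measurable_fun_coord.
Qed.

Lemma measurable_scalar_mx n (a : T -> R) :
  measurable_fun [set: T] a ->
  measurable_fun [set: T] (fun x => (a x)%:M : 'M[R]_n).
Proof.
move=> ma; apply: measurable_fun_matrixP => i j.
under eq_fun do rewrite mxE.
by case: (i == j) => //=; exact: measurable_cst.
Qed.

End measurable_matrix_operations.

(** * Coordinates of symmetric matrices and slicing of tuple integrals *)

Definition colt (R : realType) k (t : k.-tuple R) : 'cV[R]_k := \col_i tnth t i.

Lemma measurable_colt (R : realType) k :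
  measurable_fun [set: k.-tuple R] (@colt R k).
Proof.
apply: measurable_fun_matrixP => i j.
by under eq_fun do rewrite mxE; exact: measurable_tnth.
Qed.

Definition tuple_of_sym (R : realType) d (M : 'M[R]_d) : (sym_dim d).-tuple R :=
  tcast (size_upper_pairs d)
    (map_tuple (fun p => M p.1 p.2) (in_tuple (upper_pairs d))).

Lemma measurable_tuple_of_sym (R : realType) d :
  measurable_fun [set: 'M[R]_d] (@tuple_of_sym R d).
Proof.
apply/measurable_fun_tnthP => i /=.
have ip : (i < size (upper_pairs d))%N by rewrite size_upper_pairs.
case E : (upper_pairs d) ip => [//|p0 s]; rewrite -E => ip.
pose p := nth p0 (upper_pairs d) i.
rewrite (_ : _ \o _ = fun M : 'M[R]_d => M p.1 p.2).
  exact: measurable_fun_coord.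
apply/funext => M /=; rewrite (tnth_nth 0) /tuple_of_sym val_tcast /=.
by rewrite (nth_map p0).
Qed.

(** Each position occurs once in [upper_pairs], so looking up its index recovers the coordinate.
    This left inverse is what makes [lsym] sigma-finite. *)
Lemma sym_of_tupleK (R : realType) d : cancel (@sym_of_tuple R d) (@tuple_of_sym R d).
Proof.
move=> t; apply: val_inj; rewrite /tuple_of_sym /= val_tcast /=.
apply: (@eq_from_nth _ 0); rewrite size_map size_upper_pairs ?size_tuple// => i id.
have ip : (i < size (upper_pairs d))%N by rewrite size_upper_pairs.
case E : (upper_pairs d) ip => [//|p0 s]; rewrite -E => ip.
rewrite (nth_map p0)// !mxE.
have : nth p0 (upper_pairs d) i \in upper_pairs d by exact: mem_nth.
rewrite mem_filter => /andP[-> _].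
rewrite -surjective_pairing index_uniq//.
by rewrite filter_uniq// enum_uniq.
Qed.

(** Only the entries on and above the diagonal are stored; symmetry restores the others. It lets a
    translation by a symmetric matrix be read as a translation of tuples. *)
Lemma tuple_of_symK (R : realType) d (M : 'M[R]_d) :
  M^T = M -> sym_of_tuple (tuple_of_sym M) = M.
Proof.
move=> MT; apply/matrixP => i j; rewrite mxE /tuple_of_sym val_tcast /=.
have upE (k l : 'I_d) : (k <= l)%N -> (k, l) \in upper_pairs d.
  by move=> kl; rewrite mem_filter kl mem_enum.
rewrite (nth_map (i, j)) ?index_mem ?nth_index; last 2 first.
- by case: leqP => [/upE//|/ltnW/upE].
- by case: leqP => [/upE//|/ltnW/upE].
by case: leqP => //= _; rewrite -[in LHS]MT mxE.
Qed.

Lemma sigma_finite_lsym (R : realType) d : sigma_finite setT (lsym R d).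
Proof.
refine (@sigma_finite_image_measure _ _ ((sym_dim d).-tuple R) 'M[R]_d R _ _
  (@measurable_sym_of_tuple R d) (@tuple_of_sym R d) _ _
  (@sigma_finite_lebesgue_tuple R _)).
- exact: measurable_tuple_of_sym.
- exact: sym_of_tupleK.
Qed.

HB.instance Definition _ R d := Measure_isSigmaFinite.Build _ _ _ (lsym R d)
  (@sigma_finite_lsym R d).

Section integral_tuple.
Variable R : realType.
Local Open Scope ereal_scope.

Lemma measurable_cat_tuple m n :
  measurable_fun [set: m.-tuple R * n.-tuple R]
    (fun z : m.-tuple R * n.-tuple R => [tuple of z.1 ++ z.2]).
Proof.
apply/measurable_fun_tnthP => i; case: (split_ordP i) => k ->.
  rewrite (_ : _ \o _ = fun z : _ * _ => tnth z.1 k); last first.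
    by apply/funext => z /=; rewrite tnth_lshift.
  exact: measurableT_comp (measurable_tnth _) measurable_fst.
rewrite (_ : _ \o _ = fun z : _ * _ => tnth z.2 k); last first.
    by apply/funext => z /=; rewrite tnth_rshift.
exact: measurableT_comp (measurable_tnth _) measurable_snd.
Qed.

(** Used with [u] the first row of a symmetric matrix right of the corner and [v] the coordinates of
    its lower right block. *)
Lemma integral_leb_cat m n (f : (m + n).-tuple R -> \bar R) :
  measurable_fun [set: (m + n).-tuple R] f -> (forall t, 0 <= f t) ->
  \int[leb R (m + n)]_t f t =
  \int[leb R m]_u \int[leb R n]_v f [tuple of u ++ v].
Proof.
have mcons k (x : R) : measurable_fun [set: k.-tuple R]
    (fun t : k.-tuple R => [tuple of x :: t]) by exact: measurable_cons.
elim: m f => [|m IH] f mf f0.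
  rewrite integral_leb0.
    by apply: eq_integral => t _; congr f; exact: val_inj.
  apply: (measurable_fun_fubini_tonelli_F (m2 := leb R n)
    (fun z : 0.-tuple R * n.-tuple R => f [tuple of z.1 ++ z.2])) => //.
  exact: (measurableT_comp mf (@measurable_cat_tuple _ _)).
have mf2 : measurable_fun [set: m.+1.-tuple R]
    (fun u => \int[leb R n]_v f [tuple of u ++ v]).
  apply: (measurable_fun_fubini_tonelli_F (m2 := leb R n)
    (fun z : m.+1.-tuple R * n.-tuple R => f [tuple of z.1 ++ z.2])) => //.
  exact: (measurableT_comp mf (@measurable_cat_tuple _ _)).
rewrite integral_lebS => [|//|u]; last exact: integral_ge0.
rewrite integral_lebS//; apply: eq_integral => x _.
have mfx := measurableT_comp mf (mcons (m + n)%N x).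
apply: etrans (IH _ mfx (fun=> f0 _)) _.
apply: eq_integral => u _; apply: eq_integral => v _.
by congr f; exact: val_inj.
Qed.

Lemma integral_leb_tcast m n (e : m = n) (f : n.-tuple R -> \bar R) :
  \int[leb R n]_t f t = \int[leb R m]_t f (tcast e t).
Proof. by case: n / e f. Qed.

Definition add_tuple k (t w : k.-tuple R) : k.-tuple R :=
  [tuple (tnth t i + tnth w i)%R | i < k].

Lemma measurable_add_tuple k (w : k.-tuple R) :
  measurable_fun [set: k.-tuple R] (fun t => add_tuple t w).
Proof.
apply/measurable_fun_tnthP => i.
rewrite (_ : _ \o _ = fun t : k.-tuple R => (tnth t i + tnth w i)%R).
  by apply: measurable_funD => //; exact: measurable_tnth.
by apply/funext => t /=; rewrite tnth_mktuple.
Qed.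

Lemma integral_leb_shift k (w : k.-tuple R) (f : k.-tuple R -> \bar R) :
  measurable_fun [set: k.-tuple R] f -> (forall t, 0 <= f t) ->
  \int[leb R k]_t f (add_tuple t w) = \int[leb R k]_t f t.
Proof.
elim: k w f => [|k IH] w f mf f0.
  apply: eq_integral => t _; congr f.
  by apply: eq_from_tnth => -[].
have mfw : measurable_fun [set: k.+1.-tuple R] (fun t => f (add_tuple t w)).
  exact: (measurableT_comp mf (@measurable_add_tuple _ w)).
have mcons : measurable_fun [set: R * k.-tuple R]
    (fun z : R * k.-tuple R => [tuple of z.1 :: z.2]) by exact: measurable_cons.
rewrite !integral_lebS//.
have mF : measurable_fun [set: R] (fun x => \int[leb R k]_t f [tuple of x :: t]).
  apply: (measurable_fun_fubini_tonelli_F (m2 := leb R k)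
    (fun z : R * k.-tuple R => f [tuple of z.1 :: z.2])) => //.
  exact: (measurableT_comp mf mcons).
rewrite -[RHS](@integral_lebesgue_shift _ _ (thead w))//; last first.
  by move=> x; exact: integral_ge0.
apply: eq_integral => x _.
have mfx : measurable_fun [set: k.-tuple R]
    (fun t : k.-tuple R => f [tuple of (x + thead w)%R :: t]).
  exact: (measurableT_comp mf (measurable_cons _ _)).
rewrite -(IH [tuple of behead w] _ mfx)//.
apply: eq_integral => t _; congr f; apply: eq_from_tnth => i.
rewrite tnth_mktuple; case: (unliftP ord0 i) => [j|] ->; last by rewrite !tnth0.
rewrite !tnthS tnth_mktuple; congr (_ + _)%R.
by rewrite [in LHS](tuple_eta w) tnthS.
Qed.

Lemma ge0_integral_lsym d (f : 'M[R]_d -> \bar R) :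
  measurable_fun [set: 'M[R]_d] f -> (forall S, 0 <= f S) ->
  \int[lsym R d]_S f S = \int[leb R (sym_dim d)]_t f (sym_of_tuple t).
Proof.
move=> mf f0; rewrite /lsym.
by rewrite (ge0_integral_pushforward (@measurable_sym_of_tuple R d)).
Qed.

(** For symmetric [W] the map [S -> S + W] is the translation of the coordinate tuple by
    [tuple_of_sym W], which preserves [leb]. *)
Lemma integral_lsym_shift d (W : 'M[R]_d) (f : 'M[R]_d -> \bar R) :
  W^T = W -> measurable_fun [set: 'M[R]_d] f -> (forall S, 0 <= f S) ->
  \int[lsym R d]_S f (S + W)%R = \int[lsym R d]_S f S.
Proof.
move=> WT mf f0; rewrite !ge0_integral_lsym//; last first.
  apply: (measurableT_comp mf); apply: measurable_addmx => //.
rewrite -[RHS](@integral_leb_shift _ (tuple_of_sym W))//; last first.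
  exact: (measurableT_comp mf (@measurable_sym_of_tuple R d)).
apply: eq_integral => t _; congr f; rewrite -[in LHS](tuple_of_symK WT).
apply/matrixP => i j; rewrite !mxE.
set k := index _ _.
have kd : (k < sym_dim d)%N.
  rewrite -size_upper_pairs index_mem mem_filter mem_enum andbT.
  by case: ifPn => //=; rewrite -ltnNge; exact: ltnW.
by rewrite -[k]/(nat_of_ord (Ordinal kd)) -!tnth_nth tnth_mktuple.
Qed.

End integral_tuple.

(** * Block decomposition of the Lebesgue measure on symmetric matrices *)

(** The lexicographic order lists the first row before everything else, and what follows is the list
    for dimension [d] with both indices shifted. Coordinates thus come as corner, rest of the first
    row, lower right block. *)
Lemma upper_pairsS d : upper_pairs d.+1 =
  (ord0, ord0) :: [seq (ord0, lift ord0 j) | j <- enum 'I_d] ++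
  [seq (lift ord0 p.1, lift ord0 p.2) | p <- upper_pairs d].
Proof.
have enumE k :
    enum {: 'I_k * 'I_k} = [seq (i, j) | i <- enum 'I_k, j <- enum 'I_k].
  by rewrite enumT unlock.
rewrite /upper_pairs !enumE enum_ordSl /= filter_cat; congr cons; congr cat.
  rewrite -map_comp filter_map; congr map.
  exact/all_filterP/allP.
set e := enum 'I_d.
(* The list of rows is generalised while the list of columns [e] stays fixed, so that the induction
   runs over rows. In each such row the column [ord0] lies below the diagonal and is filtered
   out. *)
suff: forall s : seq 'I_d, [seq p : 'I_d.+1 * 'I_d.+1 <-
      [seq (i, j) | i <- map (lift ord0) s, j <- ord0 :: map (lift ord0) e]
        | (p.1 <= p.2)%N] =
    [seq (lift ord0 p.1, lift ord0 p.2) |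
      p <- [seq p : 'I_d * 'I_d <- [seq (i, j) | i <- s, j <- e] | (p.1 <= p.2)%N]].
  by move=> /(_ e).
elim=> // i s IH.
rewrite /= !filter_cat map_cat IH; congr cat.
by rewrite !filter_map -!map_comp.
Qed.

Lemma sym_dimS d : (d + sym_dim d).+1 = sym_dim d.+1.
Proof.
rewrite -(size_upper_pairs d.+1) upper_pairsS /= size_cat !size_map.
by rewrite -enumT size_upper_pairs size_enum_ord.
Qed.

Section sym_blocks.
Variable R : realType.

Definition sym_block d (a : R) (v : 'cV[R]_d) (B : 'M[R]_d) : 'M[R]_(1 + d) :=
  block_mx a%:M v^T v B.

Lemma sym_of_tuple_cons d (a : R) (v : d.-tuple R) (t : (sym_dim d).-tuple R) :
  sym_of_tuple (tcast (sym_dimS d) [tuple of a :: [tuple of v ++ t]]) =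
  sym_block a (colt v) (sym_of_tuple t).
Proof.
have idx0 j : index (ord0, lift ord0 j) (upper_pairs d.+1) = j.+1.
  rewrite upper_pairsS /= index_cat ifT; last by apply/map_f; rewrite mem_enum.
  rewrite index_map => [|x y [xy]]; first by rewrite index_enum_ord.
  exact: val_inj.
have idxS i j : index (lift ord0 i, lift ord0 j) (upper_pairs d.+1) =
    (d + index (i, j) (upper_pairs d)).+1.
  rewrite upper_pairsS /= index_cat ifF; last by apply/negP => /mapP[].
  rewrite size_map size_enum_ord.
  rewrite -[X in index X _]/((fun p => (lift ord0 p.1, lift ord0 p.2)) (i, j)).
  by rewrite index_map // => -[x y] [x' y'] [xx' yy']; congr pair; exact: val_inj.
have nth0 j : (tcast (sym_dimS d) [tuple of a :: [tuple of v ++ t]])`_j.+1 =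
    (v ++ t)`_j by rewrite val_tcast.
have sh0 (i : 'I_1) : lshift d i = ord0 by apply: val_inj; rewrite /= ord1.
apply/matrixP => i j; rewrite /sym_block /sym_of_tuple mxE.
(* Indices in ['I_d.+1] are read in the convertible type ['I_(1 + d)], which is why the block lemmas
   below receive their dimensions explicitly. *)
case: (@split_ordP 1 d i) => {}i ->; case: (@split_ordP 1 d j) => {}j ->.
- apply: etrans _ (esym (@block_mxEul R 1 d 1 d _ _ _ _ i j)).
  rewrite !sh0 upper_pairsS /= val_tcast /= !ord1.
  by rewrite mxE.
- apply: etrans _ (esym (@block_mxEur R 1 d 1 d _ _ _ _ i j)).
  rewrite !mxE sh0 rshift1 /= idx0 nth0.
  by rewrite nth_cat size_tuple ltn_ord (tnth_nth 0).
- apply: etrans _ (esym (@block_mxEdl R 1 d 1 d _ _ _ _ i j)).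
  rewrite !mxE sh0 rshift1 /= idx0 nth0.
  by rewrite nth_cat size_tuple ltn_ord (tnth_nth 0).
- apply: etrans _ (esym (@block_mxEdr R 1 d 1 d _ _ _ _ i j)).
  rewrite !mxE !rshift1 /= /bump /= !add1n ltnS.
  by case: ifP => ij; rewrite idxS nth0 nth_cat size_tuple ltnNge leq_addr addKn.
Qed.

Lemma measurable_sym_block d dT (T : measurableType dT) (a : T -> R)
    (v : T -> 'cV[R]_d) (B : T -> 'M[R]_d) :
  measurable_fun [set: T] a -> measurable_fun [set: T] v ->
  measurable_fun [set: T] B ->
  measurable_fun [set: T] (fun x => sym_block (a x) (v x) (B x)).
Proof.
move=> ma mv mB; apply: measurable_block_mx => //.
  exact: measurable_scalar_mx.
exact: measurable_trmx.
Qed.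

Local Open Scope ereal_scope.

Lemma tonelli_lebesgue d2 (T2 : measurableType d2)
    (m2 : {sigma_finite_measure set T2 -> \bar R}) (f : R * T2 -> \bar R) :
  measurable_fun [set: R * T2] f -> (forall z, 0 <= f z) ->
  \int[lebesgue_measure]_x \int[m2]_y f (x, y) =
  \int[m2]_y \int[lebesgue_measure]_x f (x, y).
Proof. exact: (@fubini_tonelli _ _ (measurableTypeR R) T2 R lebesgue_measure m2 f). Qed.

(** Brings the scalar variable innermost, where it can be translated by an amount depending on the
    other two. *)
Lemma tonelli_lebesgue3 d1 d2 (T1 : measurableType d1) (T2 : measurableType d2)
    (m1 : {sigma_finite_measure set T1 -> \bar R})
    (m2 : {sigma_finite_measure set T2 -> \bar R}) (f : R * (T1 * T2) -> \bar R) :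
  measurable_fun [set: R * (T1 * T2)] f -> (forall z, 0 <= f z) ->
  \int[lebesgue_measure]_x \int[m1]_y \int[m2]_z f (x, (y, z)) =
  \int[m1]_y \int[m2]_z \int[lebesgue_measure]_x f (x, (y, z)).
Proof.
move=> mf f0.
rewrite (tonelli_lebesgue m1 (f := fun w => \int[m2]_z f (w.1, (w.2, z)))).
- apply: eq_integral => y _.
  apply: (tonelli_lebesgue m2 (f := fun w => f (w.1, (y, w.2)))) => //.
  apply: (measurableT_comp mf); apply: measurable_fun_pair => //.
  by apply: measurable_fun_pair => //; exact: measurable_cst.
- apply: (measurable_fun_fubini_tonelli_F (m2 := m2)
    (fun z => f (z.1.1, (z.1.2, z.2)))) => //.
  apply: (measurableT_comp mf); apply: measurable_fun_pair.
    exact: (measurableT_comp measurable_fst).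
  apply: measurable_fun_pair => //.
  exact: (measurableT_comp measurable_snd).
- by move=> w; exact: integral_ge0.
Qed.

Lemma integral_lsymS d (f : 'M[R]_(1 + d) -> \bar R) :
  measurable_fun [set: 'M[R]_(1 + d)] f -> (forall S, 0 <= f S) ->
  \int[lsym R (1 + d)]_S f S =
  \int[lebesgue_measure]_a \int[leb R d]_v \int[lsym R d]_B f (sym_block a (colt v) B).
Proof.
move=> mf f0; rewrite ge0_integral_lsym//.
have mft : measurable_fun [set: (sym_dim (1 + d)).-tuple R]
    (fun t => f (sym_of_tuple t)).
  exact: (measurableT_comp mf (@measurable_sym_of_tuple R _)).
rewrite -[sym_dim (1 + d)]/(sym_dim d.+1).
rewrite (integral_leb_tcast (sym_dimS d)).
have mtc m n (e : m = n) : measurable_fun [set: m.-tuple R]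
    (fun t : m.-tuple R => tcast e t) by case: n / e; exact: measurable_id.
have mftc := measurableT_comp mft (mtc _ _ (sym_dimS d)).
rewrite integral_lebS//; apply: eq_integral => a _.
have mfa : measurable_fun [set: (d + sym_dim d).-tuple R] (fun t =>
    f (sym_of_tuple (tcast (sym_dimS d) [tuple of a :: t]))).
  exact: (measurableT_comp mftc (measurable_cons _ _)).
rewrite (integral_leb_cat mfa)//; apply: eq_integral => v _.
rewrite [RHS]ge0_integral_lsym//.
  by apply: eq_integral => t _; rewrite sym_of_tuple_cons.
apply: (measurableT_comp mf); apply: measurable_sym_block => //; exact: measurable_cst.
Qed.

(** With [a] and [v] fixed, the lower right block is translated by the symmetric matrix
    [a^-1 *: (v *m v^T)], which is 0 when [a = 0]. Tonelli then puts [v] innermost, ready for the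
    Gaussian integral. *)
Lemma integral_schur_lower d (f : 'M[R]_(1 + d) -> \bar R) :
  measurable_fun [set: 'M[R]_(1 + d)] f -> (forall S, 0 <= f S) ->
  \int[lsym R (1 + d)]_S f S =
  \int[lebesgue_measure]_a \int[lsym R d]_C \int[leb R d]_v
    f (sym_block a (colt v) (C + a^-1 *: (colt v *m (colt v)^T))%R).
Proof.
move=> mf f0; rewrite integral_lsymS//; apply: eq_integral => a _.
have mv : measurable_fun [set: 'M[R]_d * d.-tuple R]
    (fun z : 'M[R]_d * d.-tuple R => colt z.2).
  exact: (measurableT_comp (@measurable_colt R d)).
transitivity (\int[leb R d]_v \int[lsym R d]_C
    f (sym_block a (colt v) (C + a^-1 *: (colt v *m (colt v)^T))%R)).
  apply: eq_integral => v _.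
  rewrite (@integral_lsym_shift _ _ _ (fun B => f (sym_block a (colt v) B)))//.
    by rewrite linearZ /= trmx_mul trmxK.
  apply: (measurableT_comp mf); apply: measurable_sym_block => //; exact: measurable_cst.
rewrite -(@fubini_tonelli _ _ _ _ _ (lsym R d) (leb R d) (fun z =>
  f (sym_block a (colt z.2) (z.1 + a^-1 *: (colt z.2 *m (colt z.2)^T))%R)))//.
apply: (measurableT_comp mf); apply: measurable_sym_block => //.
apply: measurable_addmx => //; apply: measurable_scalemx => //.
by apply: measurable_mulmx => //; exact: measurable_trmx.
Qed.

(** Here it is the corner that is translated, with [D] and [v] fixed, by the value of a quadratic
    form. For singular [D] the term [invmx D] is still a fixed matrix, and the translation remains
    legitimate. *)
Lemma integral_schur_upper d (f : 'M[R]_(1 + d) -> \bar R) :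
  measurable_fun [set: 'M[R]_(1 + d)] f -> (forall S, 0 <= f S) ->
  \int[lsym R (1 + d)]_S f S =
  \int[lebesgue_measure]_a \int[lsym R d]_D \int[leb R d]_v
    f (sym_block (a + ((colt v)^T *m invmx D *m colt v) 0 0)%R (colt v) D).
Proof.
move=> mf f0; rewrite integral_lsymS//.
pose q (z : 'M[R]_d * d.-tuple R) : R :=
  ((colt z.2)^T *m invmx z.1 *m colt z.2)%R 0%R 0%R.
have mv : measurable_fun [set: 'M[R]_d * d.-tuple R]
    (fun z : 'M[R]_d * d.-tuple R => colt z.2).
  exact: (measurableT_comp (@measurable_colt R d)).
have mq : measurable_fun setT q.
  apply: measurable_fun_coord; apply: measurable_mulmx => //.
  by apply: measurable_mulmx; [exact: measurable_trmx|exact: measurable_invmx].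
pose g (x : R * ('M[R]_d * d.-tuple R)) := sym_block x.1 (colt x.2.2) x.2.1.
have mg : measurable_fun setT g.
  apply: measurable_sym_block => //; first exact: (measurableT_comp mv).
  exact: (measurableT_comp measurable_fst).
pose h (x : R * ('M[R]_d * d.-tuple R)) := g ((x.1 + q x.2)%R, x.2).
have mh : measurable_fun setT h.
  apply: (measurableT_comp mg); apply: measurable_fun_pair => //.
  by apply: measurable_funD => //; exact: (measurableT_comp mq).
transitivity (\int[lebesgue_measure]_a \int[lsym R d]_D \int[leb R d]_v
    f (g (a, (D, v)))).
  apply: eq_integral => a _.
  rewrite -(@fubini_tonelli _ _ _ _ _ (lsym R d) (leb R d) (fun z =>
    f (g (a, z))))//.
  apply: (measurableT_comp mf); apply: (measurableT_comp mg).
  by apply: measurable_fun_pair => //; exact: measurable_cst.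
have mfg := measurableT_comp mf mg; have mfh := measurableT_comp mf mh.
(* The corner variable is moved innermost on both sides; there the two integrals differ by the
   translation by [q (D, v)]. *)
apply: etrans (tonelli_lebesgue3 (lsym R d) (leb R d) mfg (fun=> f0 _)) _.
apply: etrans _ (esym (tonelli_lebesgue3 (lsym R d) (leb R d) mfh (fun=> f0 _))).
apply: eq_integral => D _; apply: eq_integral => v _.
rewrite -[LHS](@integral_lebesgue_shift _ _ (q (D, v)))//.
  2: by move=> x; exact: f0.
apply: (measurableT_comp mf); apply: (measurableT_comp mg).
by apply: measurable_fun_pair => //; exact: measurable_cst.
Qed.

End sym_blocks.

(** * Positive definite block matrices *)

Section posdef_blocks.
Variable R : realType.

(** Quadratic forms and inner products share this notation: [bil u 1%:M v] is the inner product of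
    [u] and [v]. *)
Definition bil m n (u : 'cV[R]_m) (X : 'M[R]_(m, n)) (v : 'cV[R]_n) : R :=
  (u^T *m X *m v) 0 0.

Lemma bilC d (X : 'M[R]_d) (u v : 'cV[R]_d) : X^T = X -> bil u X v = bil v X u.
Proof.
move=> XT; rewrite /bil.
have -> : v^T *m X *m u = (u^T *m X *m v)^T by rewrite !trmx_mul trmxK XT mulmxA.
by rewrite [RHS]mxE.
Qed.

Lemma bilDl m n (u u' : 'cV[R]_m) (X : 'M[R]_(m, n)) (v : 'cV[R]_n) :
  bil (u + u') X v = bil u X v + bil u' X v.
Proof. by rewrite /bil linearD /= !mulmxDl mxE. Qed.

Lemma bilDr m n (u : 'cV[R]_m) (X : 'M[R]_(m, n)) (v v' : 'cV[R]_n) :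
  bil u X (v + v') = bil u X v + bil u X v'.
Proof. by rewrite /bil mulmxDr mxE. Qed.

Lemma bilDm m n (u : 'cV[R]_m) (X Y : 'M[R]_(m, n)) (v : 'cV[R]_n) :
  bil u (X + Y) v = bil u X v + bil u Y v.
Proof. by rewrite /bil mulmxDr mulmxDl mxE. Qed.

Lemma bilZl m n a (u : 'cV[R]_m) (X : 'M[R]_(m, n)) (v : 'cV[R]_n) :
  bil (a *: u) X v = a * bil u X v.
Proof. by rewrite /bil linearZ /= -!scalemxAl mxE. Qed.

Lemma bilZr m n a (u : 'cV[R]_m) (X : 'M[R]_(m, n)) (v : 'cV[R]_n) :
  bil u X (a *: v) = a * bil u X v.
Proof. by rewrite /bil -scalemxAr mxE. Qed.

Lemma bilZm m n a (u : 'cV[R]_m) (X : 'M[R]_(m, n)) (v : 'cV[R]_n) :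
  bil u (a *: X) v = a * bil u X v.
Proof. by rewrite /bil -scalemxAr -scalemxAl mxE. Qed.

Lemma bil0l m n (X : 'M[R]_(m, n)) (v : 'cV[R]_n) : bil 0 X v = 0.
Proof. by rewrite /bil trmx0 !mul0mx mxE. Qed.

Lemma bil0r m n (X : 'M[R]_(m, n)) (u : 'cV[R]_m) : bil u X 0 = 0.
Proof. by rewrite /bil mulmx0 mxE. Qed.

Lemma bil_col_mx m n (x1 : 'cV[R]_m) (x2 : 'cV[R]_n) A B C D (y1 : 'cV[R]_m)
    (y2 : 'cV[R]_n) :
  bil (col_mx x1 x2) (block_mx A B C D) (col_mx y1 y2) =
  bil x1 A y1 + bil x1 B y2 + bil x2 C y1 + bil x2 D y2.
Proof.
rewrite /bil tr_col_mx mul_row_block mul_row_col !mulmxDl.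
by rewrite !mxE !addrA; congr (_ + _); rewrite -!addrA; congr (_ + _); rewrite addrC.
Qed.

Lemma posdef_congr d (X P : 'M[R]_d) :
  P \in unitmx -> posdef X -> posdef (P^T *m X *m P).
Proof.
move=> Pu [XT Xp]; split; first by rewrite !trmx_mul trmxK XT mulmxA.
move=> u u0.
have -> : u^T *m (P^T *m X *m P) *m u = (P *m u)^T *m X *m (P *m u).
  by rewrite trmx_mul !mulmxA.
by apply: Xp; apply: contra u0 => /eqP Pu0; rewrite -(mulKmx Pu u) Pu0 mulmx0.
Qed.

Lemma posdef_unit d (X : 'M[R]_d) : posdef X -> X \in unitmx.
Proof.
move=> [XT Xp]; rewrite unitmxE unitfE; apply/negP => /det0P[v v0 vX].
have := Xp v^T; rewrite trmxK vX mul0mx mxE ltxx.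
suff vT : v^T != 0 by move=> /(_ vT).
by apply: contra v0 => /eqP vT0; rewrite -[v]trmxK vT0 trmx0.
Qed.

Lemma posdef_inv d (X : 'M[R]_d) : posdef X -> posdef (invmx X).
Proof.
move=> Xpd; have Xu := posdef_unit Xpd.
have XiT : (invmx X)^T = invmx X by rewrite trmx_inv; case: Xpd => ->.
have := @posdef_congr _ X (invmx X); rewrite unitmx_inv XiT mulVmx// mul1mx.
exact.
Qed.

Lemma posdefZ d a (X : 'M[R]_d) : 0 < a -> posdef X -> posdef (a *: X).
Proof.
move=> a0 [XT Xp]; split; first by rewrite linearZ /= XT.
by move=> u /Xp u0; rewrite -scalemxAr -scalemxAl mxE mulr_gt0.
Qed.

Lemma posdefD d (X Y : 'M[R]_d) : posdef X -> posdef Y -> posdef (X + Y).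
Proof.
move=> [XT Xp] [YT Yp]; split; first by rewrite linearD /= XT YT.
by move=> u u0; rewrite mulmxDr mulmxDl mxE addr_gt0 ?Xp ?Yp.
Qed.

Lemma posdef1 d : posdef (1%:M : 'M[R]_d).
Proof.
split=> [|u u0]; first exact: trmx1.
rewrite mulmx1 mxE lt_neqAle eq_sym psumr_neq0; last first.
  by move=> i _; rewrite mxE -expr2 sqr_ge0.
rewrite sumr_ge0 ?andbT; last by move=> i _; rewrite mxE -expr2 sqr_ge0.
have /cV0Pn[i ui] := u0; apply/hasP; exists i; rewrite ?mem_index_enum//=.
by rewrite mxE -expr2 exprn_even_gt0.
Qed.

(* The symmetric matrices with top left entry [a], resp. lower right block [D],
   parametrised by the Schur complement [C], resp. [a]. *)
Definition schur_lower d (a : R) (v : 'cV[R]_d) (C : 'M[R]_d) : 'M[R]_(1 + d) :=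
  sym_block a v (C + a^-1 *: (v *m v^T)).

Definition schur_upper d (a : R) (v : 'cV[R]_d) (D : 'M[R]_d) : 'M[R]_(1 + d) :=
  sym_block (a + bil v (invmx D) v) v D.

Lemma posdef_diag_block d (a : R) (C : 'M[R]_d) :
  posdef (block_mx (a%:M : 'M[R]_1) 0 0 C) <-> 0 < a /\ posdef C.
Proof.
have qE x (y : 'cV[R]_d) : let u := col_mx (x%:M : 'cV[R]_1) y in
    (u^T *m block_mx (a%:M : 'M[R]_1) 0 0 C *m u) 0 0 = a * x ^+ 2 + bil y C y.
  rewrite /= -/(bil _ _ _) bil_col_mx /bil mul_mx_scalar mulmx0 mulmx0 !mul0mx.
  rewrite tr_scalar_mx mul_scalar_mx; congr (_ + _).
  by rewrite !mxE eqxx mulr1n !addr0; ring.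
split=> [[XT Xp]|[a0 [CT Cp]]].
  split; [|split].
  - have := Xp (col_mx 1%:M 0); rewrite qE bil0l addr0 expr1n mulr1.
    by apply; rewrite col_mx_eq0 negb_and oner_neq0.
  - by move: XT; rewrite tr_block_mx => /eq_block_mx[].
  - move=> u u0; have := Xp (col_mx (0%:M) u).
    rewrite qE expr0n mulr0 add0r; apply.
    by rewrite col_mx_eq0 negb_and u0 orbT.
split; first by rewrite tr_block_mx !trmx0 tr_scalar_mx CT.
move=> u; rewrite -(vsubmxK u) [usubmx u]mx11_scalar => u0.
rewrite qE; have [y0|y0] := eqVneq (dsubmx u) 0.
  rewrite y0 bil0l addr0 mulr_gt0// exprn_even_gt0//=.
  by apply: contra u0 => /eqP ->; rewrite y0 raddf0 col_mx0.
apply: ltr_wpDl; last exact: Cp.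
by rewrite mulr_ge0 ?sqr_ge0 ?(ltW a0).
Qed.

(** The elimination matrix: congruence by it or by its transpose clears the off-diagonal block and
    keeps the determinant. *)
Definition unit_lower d (v : 'cV[R]_d) : 'M[R]_(1 + d) := block_mx 1%:M 0 v 1%:M.

Lemma det_unit_lower d (v : 'cV[R]_d) : \det (unit_lower v) = 1.
Proof. by rewrite det_lblock !det1 mulr1. Qed.

Lemma mul_unit_lowerN d (v : 'cV[R]_d) : unit_lower v *m unit_lower (- v) = 1%:M.
Proof.
rewrite /unit_lower mulmx_block !mulmx1 !mul1mx !mulmx0 !mul0mx !addr0 ?add0r subrr.
by rewrite -scalar_mx_block.
Qed.

Lemma schur_lower_factor d (a : R) (v : 'cV[R]_d) C : a != 0 ->
  schur_lower a v C =
  unit_lower (a^-1 *: v) *m block_mx a%:M 0 0 C *m (unit_lower (a^-1 *: v))^T.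
Proof.
move=> a0; rewrite /schur_lower /sym_block /unit_lower tr_block_mx
  !mulmx_block !trmx1 trmx0.
rewrite !mul1mx !mulmx1 !mul0mx !mulmx0 !addr0 !add0r !linearZ /=.
rewrite mul_scalar_mx mul_mx_scalar !scalerA mulVf// mulfV// !scale1r.
by rewrite [in RHS]addrC.
Qed.

Lemma schur_upper_factor d (a : R) (v : 'cV[R]_d) D : D \in unitmx -> D^T = D ->
  schur_upper a v D = (unit_lower (invmx D *m v))^T *m block_mx a%:M 0 0 D *m
               unit_lower (invmx D *m v).
Proof.
move=> Du DT; rewrite /schur_upper /sym_block /unit_lower tr_block_mx
  !mulmx_block !trmx1 trmx0.
rewrite !mul1mx !mulmx1 !mul0mx !mulmx0 !addr0 !add0r trmx_mul trmx_inv DT.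
rewrite -!mulmxA mulVmx// mulKVmx// mulmx1; congr block_mx.
rewrite raddfD /=; congr (_ + _).
by rewrite [RHS]mx11_scalar mulmxA.
Qed.

Lemma det_schur_lower d (a : R) (v : 'cV[R]_d) C : a != 0 ->
  \det (schur_lower a v C) = a * \det C.
Proof.
move=> a0; rewrite schur_lower_factor// !det_mulmx det_tr det_unit_lower mul1r mulr1.
by rewrite det_ublock det_scalar1.
Qed.

Lemma det_schur_upper d (a : R) (v : 'cV[R]_d) D : D \in unitmx -> D^T = D ->
  \det (schur_upper a v D) = a * \det D.
Proof.
move=> Du DT; rewrite schur_upper_factor// !det_mulmx det_tr det_unit_lower mul1r mulr1.
by rewrite det_ublock det_scalar1.
Qed.

(** The form is tested on vectors supported in one block. This supplies the invertible pivot, [a] or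
    [D], that the factorizations ask for. *)
Lemma posdef_sym_block d (a : R) (v : 'cV[R]_d) B :
  posdef (sym_block a v B) -> 0 < a /\ posdef B.
Proof.
move=> [XT Xp]; split; [|split].
- have := Xp (col_mx 1%:M 0); rewrite -/(bil _ _ _) bil_col_mx !bil0l bil0r !addr0.
  rewrite /bil trmx1 mul1mx mulmx1 mxE eqxx mulr1n; apply.
  by rewrite col_mx_eq0 negb_and oner_neq0.
- by move: XT; rewrite tr_block_mx => /eq_block_mx[].
- move=> u u0; have := Xp (col_mx 0 u); rewrite -/(bil _ _ _) bil_col_mx !bil0l.
  by rewrite bil0r !add0r; apply; rewrite col_mx_eq0 negb_and u0 orbT.
Qed.

(** Congruence by an invertible matrix preserves positive definiteness in both directions, and the
    factorization reduces the claim to [posdef_diag_block]. *)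
Lemma posdef_schur_lower d (a : R) (v : 'cV[R]_d) C :
  posdef (schur_lower a v C) <-> 0 < a /\ posdef C.
Proof.
have elu : unit_lower (a^-1 *: v) \in unitmx by rewrite unitmxE det_unit_lower unitr1.
have eluT : (unit_lower (a^-1 *: v))^T \in unitmx by rewrite unitmx_tr.
split=> [Lp|[a0 Cp]].
  have [a0 _] := posdef_sym_block Lp.
  move: Lp; rewrite schur_lower_factor ?gt_eqF// => Lp.
  apply/posdef_diag_block.
  have := posdef_congr _ Lp; move=> /(_ (invmx (unit_lower (a^-1 *: v))^T)).
  by rewrite unitmx_inv eluT trmx_inv trmxK -!mulmxA mulmxV// mulmx1 mulKmx//; exact.
rewrite schur_lower_factor ?gt_eqF//.
have := @posdef_congr _ (block_mx a%:M 0 0 C) (unit_lower (a^-1 *: v))^T eluT.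
by rewrite trmxK; apply; apply/posdef_diag_block.
Qed.

Lemma posdef_schur_upper d (a : R) (v : 'cV[R]_d) D :
  posdef (schur_upper a v D) <-> 0 < a /\ posdef D.
Proof.
have elu : unit_lower (invmx D *m v) \in unitmx by rewrite unitmxE det_unit_lower unitr1.
split=> [Lp|[a0 Dp]].
  have [_ Dp] := posdef_sym_block Lp.
  have [Du DT] := (posdef_unit Dp, Dp.1).
  move: Lp; rewrite schur_upper_factor// => Lp.
  apply/posdef_diag_block.
  have := posdef_congr _ Lp; move=> /(_ (invmx (unit_lower (invmx D *m v)))).
  by rewrite unitmx_inv elu trmx_inv -!mulmxA mulmxV// mulmx1 mulKmx ?unitmx_tr//; exact.
rewrite schur_upper_factor ?posdef_unit//; last by case: Dp.
by apply: posdef_congr => //; apply/posdef_diag_block.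
Qed.

(** Through this case analysis every induction on the dimension reaches the Schur complement. *)
Variant posdef_spec d : 'M[R]_(1 + d) -> Prop :=
  PosdefSpec a v C of 0 < a & posdef C : posdef_spec (schur_lower a v C).

Lemma posdefP d (M : 'M[R]_(1 + d)) : posdef M -> posdef_spec M.
Proof.
rewrite -(submxK M) => Mp.
have := Mp.1; rewrite tr_block_mx => /eq_block_mx[_ urE _ _].
move: Mp; rewrite [ulsubmx M]mx11_scalar; set a : R := ulsubmx M 0 0.
rewrite -urE; set v := dlsubmx M.
set Q := drsubmx M; rewrite -/(sym_block a v Q).
rewrite (_ : Q = (Q - a^-1 *: (v *m v^T)) + a^-1 *: (v *m v^T)); last first.
  by rewrite subrK.
by rewrite -/(schur_lower a v _) => /posdef_schur_lower[a0 Cp]; exact: PosdefSpec.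
Qed.

Lemma posdef_det_gt0 d (M : 'M[R]_d) : posdef M -> 0 < \det M.
Proof.
elim: d M => [|d IH] M; first by rewrite det_mx00 ltr01.
by case/(@posdefP d) => a v C a0 Cp; rewrite det_schur_lower ?gt_eqF// mulr_gt0// IH.
Qed.

(** Inverting [L *m diag(a, C) *m L^T] gives [L^-T *m diag(a^-1, C^-1) *m L^-1], which is the
    factorization of the upper shape. Inversion thus exchanges the two parametrisations, with pivots
    [a^-1] and [invmx C]. *)
Lemma invmx_schur_lower d (a : R) (v : 'cV[R]_d) C :
  a != 0 -> C \in unitmx -> C^T = C ->
  invmx (schur_lower a v C) = schur_upper a^-1 (- a^-1 *: (invmx C *m v)) (invmx C).
Proof.
move=> a0 Cu CT.
have CiT : (invmx C)^T = invmx C by rewrite trmx_inv CT.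
have Lu : schur_lower a v C \in unitmx.
  by rewrite unitmxE det_schur_lower// unitrM unitfE a0 -unitmxE.
suff H : schur_lower a v C *m schur_upper a^-1 (- a^-1 *: (invmx C *m v)) (invmx C) = 1%:M.
  by rewrite -[LHS]mulmx1 -H mulmxA mulVmx// mul1mx.
rewrite schur_lower_factor// schur_upper_factor ?unitmx_inv// invmxK.
rewrite -scalemxAr mulKVmx// scaleNr; set w := a^-1 *: v.
rewrite !mulmxA -[X in X *m _ *m _]mulmxA -trmx_mul.
have -> : unit_lower (- w) *m unit_lower w = 1%:M by rewrite -{2}[w]opprK mul_unit_lowerN.
rewrite trmx1 mulmx1 -(mulmxA (unit_lower w)) mulmx_block.
rewrite !mulmx0 !mul0mx !addr0 !add0r -scalar_mxM mulfV// mulmxV//.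
by rewrite -scalar_mx_block mulmx1 mul_unit_lowerN.
Qed.

(** Separates the exponent into a term in the corner, a quadratic plus linear term in [v] and a
    trace in lower dimension. It serves both recursions, since [Y] in one and [invmx S] in the other
    have the upper shape. *)
Lemma mxtrace_schur_upper_sym_block d (a : R) (v : 'cV[R]_d) D m p Q :
  \tr (schur_upper a v D *m sym_block m p Q) =
  a * m + m * bil v (invmx D) v + 2 * bil v 1%:M p + \tr (D *m Q).
Proof.
have tE u w : \tr (u^T *m w) = bil u (1%:M : 'M[R]_d) w.
  by rewrite /bil mulmx1 trace_mx11.
rewrite /schur_upper /sym_block mulmx_block mxtrace_block !mxtraceD.
rewrite (mxtrace_mulC v) !tE [bil p _ _]bilC ?trmx1//.
rewrite -scalar_mxM mxtrace_scalar mulr1n.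
by ring.
Qed.

Lemma bil_sym_block d (a x z : R) (v y w : 'cV[R]_d) B :
  bil (col_mx x%:M y) (sym_block a v B) (col_mx z%:M w) =
  a * x * z + x * bil v 1%:M w + z * bil y 1%:M v + bil y B w.
Proof.
have b1 : bil x%:M (a%:M : 'M[R]_1) z%:M = a * x * z.
  by rewrite /bil tr_scalar_mx -!scalar_mxM mxE eqxx mulr1n (mulrC a).
have b2 : bil (x%:M : 'cV[R]_1) v^T w = x * bil v 1%:M w.
  by rewrite /bil tr_scalar_mx mul_scalar_mx -scalemxAl mxE mulmx1.
have b3 : bil y v z%:M = z * bil y 1%:M v.
  by rewrite /bil mul_mx_scalar mxE mulmx1.
by rewrite /sym_block bil_col_mx b1 b2 b3.
Qed.

Lemma bil_col_mx1 d (x z : R) (y w : 'cV[R]_d) :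
  bil (col_mx (x%:M : 'cV[R]_1) y) 1%:M (col_mx z%:M w) = x * z + bil y 1%:M w.
Proof.
have -> : 1%:M = sym_block 1 0 1%:M :> 'M[R]_(1 + d).
  by rewrite /sym_block trmx0 -scalar_mx_block.
by rewrite bil_sym_block bil0l bil0r !mulr0 !addr0 mul1r.
Qed.

Lemma bil_outer d (u v w y : 'cV[R]_d) :
  bil y (u *m v^T) w = bil y 1%:M u * bil v 1%:M w.
Proof.
rewrite /bil !mulmx1 !mulmxA -mulmxA [y^T *m u]mx11_scalar.
rewrite mul_scalar_mx [LHS]mxE; congr (_ * _).
by rewrite [RHS]mxE eqxx mulr1n.
Qed.

(** A completed square, obtained by expanding the upper shape of the inverse. It matches the
    exponent left after integrating out the first variable of a Gaussian. *)
Lemma bil_invmx_schur_lower d (a : R) (v : 'cV[R]_d) C x y : a != 0 -> C \in unitmx ->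
  C^T = C ->
  bil (col_mx x%:M y) (invmx (schur_lower a v C)) (col_mx x%:M y) =
  a^-1 * x ^+ 2 + bil (y - (x / a) *: v) (invmx C) (y - (x / a) *: v).
Proof.
move=> a0 Cu CT.
have CiT : (invmx C)^T = invmx C by rewrite trmx_inv CT.
have bM u w : bil u C (invmx C *m w) = bil u 1%:M w.
  by rewrite /bil mulmx1 -mulmxA mulKVmx// mulmxA.
rewrite invmx_schur_lower// /schur_upper bil_sym_block invmxK.
have b4 u w : bil (invmx C *m u) 1%:M w = bil u (invmx C) w.
  by rewrite /bil trmx_mul CiT mulmx1.
have b5 u w : bil u 1%:M (invmx C *m w) = bil u (invmx C) w.
  by rewrite /bil mulmx1 mulmxA.
have bNl u w : bil (- u) (invmx C) w = - bil u (invmx C) w.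
  by rewrite -scaleN1r bilZl mulN1r.
have bNr u w : bil u (invmx C) (- w) = - bil u (invmx C) w.
  by rewrite -scaleN1r bilZr mulN1r.
rewrite !(bilDl, bNl, bNr, bilDr, bilZl, bilZr, bilZm) bM !b4 !b5.
rewrite (bilC v y CiT).
by field.
Qed.

End posdef_blocks.

(** * One-dimensional integrals *)

Section inversion.
Variable R : realType.

Let is_derive_inv (c x : R) : x != 0 ->
  is_derive x 1 (fun y : R => c / y) (- (c / x ^+ 2)).
Proof.
move=> x0; have dV := @is_deriveV R id x 1 1 x0 (is_derive_id x 1).
have := is_deriveZ c dV; rewrite (_ : c \*: _ = (fun y => c / y)) // => dcV.
by apply: is_derive_eq dcV _; rewrite /GRing.scale /= mulr1 mulrN.
Qed.

Let near_pos (x : R) : 0 < x -> \forall y \near x, 0 < y.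
Proof. by move=> x0; exact: lt_nbhsr. Qed.

Let continuous_inv2 (c x : R) : x != 0 ->
  {for x, continuous (fun y : R => - (c / y ^+ 2))}.
Proof.
move=> x0; apply: continuousN; apply: continuousM; first exact: cst_continuous.
apply: continuousV; first by rewrite expf_neq0.
exact: exprn_continuous.
Qed.

Let F'E (c : R) (x : R) : 0 < x ->
  (fun y : R => c / y)^`()%classic x = - (c / x ^+ 2).
Proof.
move=> x0; rewrite derive1E; by have ? := is_derive_inv c (lt0r_neq0 x0); exact: derive_val.
Qed.

(** The decreasing substitution [x -> c / x], on a segment away from 0, where the map is
    continuously differentiable. *)
Lemma integral_inversion_itv (c a b : R) (G : R -> R) : 0 < c -> 0 < a -> a <= b ->
  {in `]0, +oo[, continuous G} ->
  (\int[lebesgue_measure]_(x in `[(c / b)%R, (c / a)%R]) (G x)%:E =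
   \int[lebesgue_measure]_(x in `[a, b]) (G (c / x) * (c / x ^+ 2))%:E)%E.
Proof.
move=> c0 a0 ab cG; have b0 := lt_le_trans a0 ab.
pose F (y : R) := c / y.
have cF' (x : R) : 0 < x -> F^`()%classic y @[y --> x] --> - (c / x ^+ 2).
  move=> x0; have h : - (c / y ^+ 2) @[y --> x] --> - (c / x ^+ 2).
    exact: continuous_inv2 (lt0r_neq0 x0).
  apply: cvg_trans h; apply: near_eq_cvg.
  by near=> y; rewrite F'E//; near: y; exact: near_pos.
rewrite (@integration_by_substitution_decreasing R F G a b)//.
- apply: eq_integral => x; rewrite inE/= in_itv/= => /andP[ax xb].
  by rewrite !fctE F'E ?opprK// (lt_le_trans a0 ax).
- move=> x y; rewrite !in_itv/= => /andP[ax _] /andP[ay _] xy.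
  by rewrite /F ltr_pM2l// ltf_pV2// posrE (lt_le_trans a0).
- move=> x; rewrite in_itv/= => /andP[ax _].
  have x0 := lt_trans a0 ax.
  by rewrite /continuous_at F'E//; exact: cF'.
- apply/cvg_ex; exists (- (c / a ^+ 2)).
  by apply: cvg_at_right_filter; exact: cF'.
- apply/cvg_ex; exists (- (c / b ^+ 2)).
  by apply: cvg_at_left_filter; exact: cF'.
- have dF x : 0 < x -> derivable F x 1.
    move=> x0; by have ? := is_derive_inv c (lt0r_neq0 x0); exact: ex_derive.
  have cF x : 0 < x -> {for x, continuous F}.
    by move=> x0; apply/differentiable_continuous/derivable1_diffP; exact: dF.
  split.
  + by move=> x; rewrite in_itv/= => /andP[ax _]; apply: dF; exact: lt_trans ax.
  + by apply: cvg_at_right_filter; exact: cF.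
  + by apply: cvg_at_left_filter; exact: cF.
- apply: continuous_in_subspaceT => x; rewrite inE/= in_itv/= => /andP[+ _].
  move=> cbx; apply: cG; rewrite in_itv/= andbT (lt_le_trans _ cbx)//.
  by rewrite divr_gt0.
Unshelve. all: end_near. Qed.

Lemma ge0_integral_inversion (c : R) (G : R -> R) : 0 < c ->
  {in `]0, +oo[, continuous G} -> (forall x, 0 < x -> 0 <= G x) ->
  (\int[lebesgue_measure]_(x in `]0%R, +oo[) (G x)%:E =
   \int[lebesgue_measure]_(x in `]0%R, +oo[) (G (c / x) * (c / x ^+ 2))%:E)%E.
Proof.
move=> c0 cG G0.
(* The map [x -> c / x] carries [A 1 n] onto [A c n], and both families increase to the open
   half-line. Monotone convergence on each side then gives two limits of the same sequence. *)
pose A (k : R) (n : nat) : set R := `[k * n.+1%:R^-1, k * n.+1%:R]%classic.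
have ndA k : 0 < k -> {homo A k : n m / (n <= m)%N >-> (n <= m)%O}.
  move=> k0 n m nm; apply/subsetPset => x; rewrite /A/= !in_itv/= => /andP[nx xn].
  apply/andP; split.
    by rewrite (le_trans _ nx)// ler_pM2l// lef_pV2 ?posrE// ler_nat.
  by rewrite (le_trans xn)// ler_pM2l// ler_nat.
have UA k : 0 < k -> \bigcup_n A k n = `]0, +oo[%classic.
  move=> k0; apply/seteqP; split=> x /=.
    case=> n _; rewrite /A/= !in_itv/= => /andP[+ _] => /lt_le_trans ->//.
    by rewrite mulr_gt0// invr_gt0.
  rewrite in_itv/= andbT => x0.
  have [N Nx] : exists N : nat, x / k < N.+1%:R.
    by exists (Num.trunc (x / k)); rewrite truncnS_gt.
  have [M Mx] : exists M : nat, k / x < M.+1%:R.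
    by exists (Num.trunc (k / x)); rewrite truncnS_gt.
  exists (maxn N M) => //; rewrite /A/= in_itv/=; apply/andP; split.
    rewrite ler_pdivrMr// mulrC -ler_pdivrMr// (le_trans (ltW Mx))//.
    by rewrite ler_nat ltnS leq_maxr.
  rewrite mulrC -ler_pdivrMr// (le_trans (ltW Nx))//.
  by rewrite ler_nat ltnS leq_maxl.
have mA k n : measurable (A k n) by exact: measurable_itv.
have oP : open (`]0, +oo[%classic : set R) by apply: interval_open.
have mG : measurable_fun (`]0, +oo[%classic : set R) G.
  by apply: open_continuous_measurable_fun => // x; rewrite inE; exact: cG.
have mH : measurable_fun (`]0, +oo[%classic : set R)
    (fun x => G (c / x) * (c / x ^+ 2)).
  apply: open_continuous_measurable_fun => //.
  move=> x xp; have x0 : 0 < x by move: xp; rewrite inE/= in_itv/= andbT.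
  have h2 : {for x, continuous (fun y : R => c / y ^+ 2)}.
    rewrite (_ : (fun y : R => _) = (fun y => - - (c / y ^+ 2))); last first.
      by apply/funext => y; rewrite opprK.
    by apply: continuousN; apply: continuous_inv2; rewrite gt_eqF.
  have h1 : {for x, continuous (fun y : R => c / y)}.
    apply: continuousM; first exact: cst_continuous.
    by apply: inv_continuous; rewrite gt_eqF.
  have h3 : {for x, continuous (G \o (fun y : R => c / y))}.
    by apply: continuous_comp => //; apply: cG; rewrite in_itv/= andbT divr_gt0.
  exact: (continuousM h3 h2).
have sub k n x : 0 < k -> A k n x -> 0 < x.
  move=> k0 Ax; have : (\bigcup_n A k n) x by exists n.
  by rewrite UA//= in_itv/= andbT.
have c1 := @ltr01 R.
have cvgA (k : R) (H : R -> R) : 0 < k ->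
    measurable_fun (`]0, +oo[%classic : set R) H ->
    (forall x, 0 < x -> 0 <= H x) ->
    (\int[lebesgue_measure]_(x in A k n) (H x)%:E @[n --> \oo] -->
     \int[lebesgue_measure]_(x in `]0%R, +oo[) (H x)%:E)%E.
  move=> k0 mH' H0; rewrite -(UA k k0).
  apply: ge0_nondecreasing_set_cvg_integral; first exact: ndA.
  - by move=> n; exact: mA.
  - move=> n; apply/measurable_EFinP; apply: measurable_funS mH' => //.
    by move=> x /(sub _ _ _ k0) x0; rewrite /= in_itv/= andbT.
  - by move=> n x /(sub _ _ _ k0) x0; rewrite lee_fin H0.
have cvgG := cvgA c G c0 mG G0.
have cvgH : (\int[lebesgue_measure]_(x in A 1%R n) (G (c / x) * (c / x ^+ 2))%:E
    @[n --> \oo] -->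
    \int[lebesgue_measure]_(x in `]0%R, +oo[) (G (c / x) * (c / x ^+ 2))%:E)%E.
  apply: cvgA => // x x0; rewrite mulr_ge0 ?G0 ?divr_gt0//.
  by rewrite divr_ge0 ?sqr_ge0// ltW.
apply: (cvg_unique _ cvgG) => //; apply: cvg_trans cvgH.
rewrite (_ : (fun i => _) = (fun n => \int[lebesgue_measure]_(x in A c n)
    (G x)%:E)%E)//.
apply/funext => n; rewrite /A !mul1r.
have n0 : 0 < n.+1%:R^-1 :> R by rewrite invr_gt0.
have nn : n.+1%:R^-1 <= n.+1%:R :> R.
  by rewrite (@le_trans _ _ 1)// ?invf_le1// ler1n.
by rewrite -(integral_inversion_itv c0 n0 nn cG) invrK.
Qed.

End inversion.

Section gamma_integral.
Variable R : realType.
Implicit Types m s : R.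

Lemma gt0_powRD (a r s : R) : 0 < a -> a `^ (r + s) = a `^ r * a `^ s.
Proof. by move=> a0; rewrite powRD// (lt0r_neq0 a0) implybT. Qed.

(* [Gamma(s + 1)]. *)
Definition gamma_int s : \bar R :=
  (\int[lebesgue_measure]_(x in `]0%R, +oo[) (x `^ s * expR (- x))%:E)%E.

Lemma gamma_int_ge0 s : (0 <= gamma_int s)%E.
Proof.
by apply: integral_ge0 => x _; rewrite lee_fin mulr_ge0 ?powR_ge0 ?expR_ge0.
Qed.

Lemma continuous_powR_pos s (x : R) : 0 < x ->
  {for x, continuous (fun y : R => y `^ s)}.
Proof.
move=> x0; apply/differentiable_continuous/derivable1_diffP.
by apply: derivable_powR; rewrite in_itv/= andbT.
Qed.

Lemma continuous_gamma_integrand m s (x : R) : 0 < x ->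
  {for x, continuous (fun y : R => y `^ s * expR (- (y * m)))}.
Proof.
move=> x0.
have h : {for x, continuous (fun y : R => expR (- (y * m)))}.
  apply: (@continuous_comp _ _ _ (fun y : R => - (y * m)) expR).
    apply: continuousN; apply: continuousM => //; exact: cst_continuous.
  exact: continuous_expR.
exact: (continuousM (continuous_powR_pos x0) h).
Qed.

Lemma measurable_gamma_inv_integrand m s :
  measurable_fun [set: R] (fun x : R => x `^ s * expR (- (m / x))).
Proof.
apply: measurable_funM; first exact: measurable_powR.
apply: measurableT_comp => //; apply: measurableT_comp => //.
by apply: measurable_funM => //; exact: measurable_invr.
Qed.

(** The inversion [x -> m / x] in [gamma_int s] produces [(m / x)^s * (m / x^2) = m^(s+1) *
    x^(-(s+2))]. *)
Lemma integral_gamma_inv m s : 0 < m ->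
  (\int[lebesgue_measure]_(x in `]0%R, +oo[)
     (x `^ (- (s + 2)) * expR (- (m / x)))%:E)%E =
  ((m `^ (- (s + 1)))%:E * gamma_int s)%E.
Proof.
move=> m0.
have -> : gamma_int s = (\int[lebesgue_measure]_(x in `]0%R, +oo[)
    ((m / x) `^ s * expR (- (m / x)) * (m / x ^+ 2))%:E)%E.
  rewrite -(@ge0_integral_inversion _ m (fun x => x `^ s * expR (- x)))//.
    move=> x; rewrite in_itv/= andbT => x0.
    rewrite (_ : (fun x => _) = fun y : R => y `^ s * expR (- (y * 1))).
      exact: continuous_gamma_integrand.
    by apply/funext => y; rewrite mulr1.
  by move=> x x0; rewrite mulr_ge0 ?powR_ge0 ?expR_ge0.
rewrite -ge0_integralZl//; last 3 first.
- apply/measurable_EFinP; apply: measurable_funTS.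
  apply: measurable_funM; last first.
    apply: measurable_funM => //; apply: measurable_invr; exact: measurable_funX.
  apply: measurable_funM.
    apply: (measurableT_comp (measurable_powR _)).
    by apply: measurable_funM => //; exact: measurable_invr.
  apply: measurableT_comp => //; apply: measurableT_comp => //.
  by apply: measurable_funM => //; exact: measurable_invr.
- move=> x; rewrite /= in_itv/= andbT => x0; rewrite lee_fin.
  by rewrite !mulr_ge0 ?powR_ge0 ?expR_ge0 ?invr_ge0 ?sqr_ge0 ?(ltW m0).
- by rewrite lee_fin powR_ge0.
apply: eq_integral => x; rewrite inE/= in_itv/= andbT => x0.
rewrite -EFinM; congr EFin.
rewrite powRM ?invr_ge0 ?(ltW m0) ?(ltW x0)//.
have -> : x^-1 `^ s = x `^ (- s) by rewrite -powR_inv1 ?ltW// -powRrM mulN1r.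
have -> : x `^ (- (s + 2)) = x `^ (- s) / x ^+ 2.
  by rewrite opprD gt0_powRD// (powR_invn 2)// ltW.
have ms : m `^ (- (s + 1)) * (m `^ s * m) = 1.
  rewrite -[X in _ * (_ * X)](powRr1 (ltW m0)) -gt0_powRD//.
  by rewrite powRN mulVf// gt_eqF// powR_gt0.
rewrite -[LHS]mul1r -[X in X * _ = _]ms; ring.
Qed.

(** The scaling is the composite of the inversions [x -> 1 / x] and [x -> m / x], the second being
    [integral_gamma_inv]. *)
Lemma integral_gamma_scale m s : 0 < m ->
  (\int[lebesgue_measure]_(x in `]0%R, +oo[)
     (x `^ s * expR (- (x * m)))%:E)%E =
  ((m `^ (- (s + 1)))%:E * gamma_int s)%E.
Proof.
move=> m0; rewrite -integral_gamma_inv//.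
rewrite (@ge0_integral_inversion _ 1 (fun x => x `^ s * expR (- (x * m))))//.
- apply: eq_integral => x; rewrite inE/= in_itv/= andbT => x0; congr EFin.
  have -> : (1 / x) `^ s = x `^ (- s).
    by rewrite div1r -powR_inv1 ?ltW// -powRrM mulN1r.
  have -> : x `^ (- (s + 2)) = x `^ (- s) / x ^+ 2.
    by rewrite opprD gt0_powRD// (powR_invn 2)// ltW.
  rewrite mulrAC !div1r; congr (_ * expR (- _)); exact: mulrC.
- by move=> x; rewrite in_itv/= andbT => x0; exact: continuous_gamma_integrand.
- by move=> x x0; rewrite mulr_ge0 ?powR_ge0 ?expR_ge0.
Qed.

(* [x^s e^-x <= (2s)^s e^(-x/2)], from [ln y < y] at [y = x / (2s)]. *)
Lemma gamma_int_fin_num s : 0 < s -> gamma_int s \is a fin_num.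
Proof.
move=> s0; rewrite ge0_fin_numE ?gamma_int_ge0//.
apply: (@le_lt_trans _ _ (\int[lebesgue_measure]_x
   (((2 * s) `^ s * 2) * exponential_pdf 2^-1 x)%:E)%E).
  apply: (@le_trans _ _ (\int[lebesgue_measure]_(x in `]0%R, +oo[)
     (((2 * s) `^ s * 2) * exponential_pdf 2^-1 x)%:E)%E); last first.
    apply: ge0_subset_integral => //.
      apply/measurable_EFinP; apply: measurable_funM => //.
      exact: measurable_exponential_pdf.
    by move=> x _; rewrite lee_fin !mulr_ge0 ?powR_ge0 ?exponential_pdf_ge0.
  apply: ge0_le_integral => //.
  - by move=> x _; rewrite lee_fin mulr_ge0 ?powR_ge0 ?expR_ge0.
  - apply/measurable_EFinP; apply: measurable_funTS; apply: measurable_funM.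
      exact: measurable_powR.
    by apply: measurableT_comp => //; exact: measurableT_comp.
  - apply/measurable_EFinP; apply: measurable_funTS; apply: measurable_funM => //.
    exact: measurable_exponential_pdf.
  - move=> x; rewrite /= in_itv/= andbT => x0; rewrite lee_fin.
    rewrite exponential_pdfE ?(ltW x0)// mulrA -(mulrA _ 2) divff ?pnatr_eq0// mulr1.
    have y0 : 0 < x / (2 * s) by rewrite divr_gt0// mulr_gt0.
    have s2 : 2 * s != 0 by rewrite mulf_neq0 ?pnatr_eq0 ?gt_eqF.
    have -> : x `^ s = (2 * s) `^ s * expR (s * ln (x / (2 * s))).
      rewrite -{1}[x](divfK s2) mulrC (@powRM _ (2 * s)) ?(ltW y0)//; last first.
        by rewrite mulr_ge0// ltW.
      by congr (_ * _); rewrite /powR gt_eqF.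
    rewrite -mulrA ler_wpM2l ?powR_ge0// -expRD ler_expR.
    have : s * ln (x / (2 * s)) <= s * (x / (2 * s)).
      by rewrite ler_pM2l// ltW// ln_sublinear.
    have -> : s * (x / (2 * s)) = x / 2 by field; rewrite gt_eqF.
    lra.
under eq_integral do rewrite EFinM.
rewrite integralZl//; last by apply: integrable_exponential_pdf.
by rewrite integral_exponential_pdf// mule1 ltry.
Qed.

End gamma_integral.

(** * Gaussian integrals *)

Section gaussian_integral.
Variable R : realType.

Lemma integral_gauss_line (q s : R) : 0 < q ->
  (\int[lebesgue_measure]_x (expR (- (q * x ^+ 2 + 2 * s * x)))%:E)%E =
  (Num.sqrt pi / Num.sqrt q * expR (s ^+ 2 / q))%:E.
Proof.
move=> q0.
(* Completing the square, [q x^2 + 2 s x = q (x + s/q)^2 - s^2/q]: a normal density of mean [-s/q]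
   and variance [1/(2q)], up to the constant [K]. *)
pose sg : R := Num.sqrt (2 * q)^-1.
have sgE : sg ^+ 2 = (2 * q)^-1 by rewrite sqr_sqrtr// invr_ge0 mulr_ge0// ltW.
have sg0 : sg != 0 by rewrite gt_eqF// sqrtr_gt0 invr_gt0 mulr_gt0.
pose K := Num.sqrt pi / Num.sqrt q * expR (s ^+ 2 / q).
have K0 : 0 <= K by rewrite !mulr_ge0 ?invr_ge0 ?sqrtr_ge0 ?expR_ge0.
transitivity (\int[lebesgue_measure]_x (K%:E * (normal_pdf (- (s / q)) sg x)%:E))%E.
  apply: eq_integral => x _; rewrite -EFinM; congr EFin.
  rewrite /normal_pdf (negbTE sg0) /normal_peak /normal_fun.
  rewrite sgE.
  have -> : (2 * q)^-1 *+ 2 = q^-1 by field; rewrite gt_eqF.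
  have -> : (2 * q)^-1 * pi *+ 2 = pi / q by field; rewrite gt_eqF.
  rewrite sqrtrM ?pi_ge0// sqrtrV ?ltW//.
  rewrite /K; set c := (_ / Num.sqrt q).
  have c0 : c != 0 by rewrite mulf_neq0 ?invr_eq0 ?gt_eqF ?sqrtr_gt0 ?pi_gt0.
  rewrite mulrACA mulfV// mul1r -expRD; congr expR; field.
  by rewrite gt_eqF.
rewrite ge0_integralZl//; last 2 first.
- by apply/measurable_EFinP; exact: measurable_normal_pdf.
- by move=> x _; rewrite lee_fin normal_pdf_ge0.
by rewrite integral_normal_pdf mule1.
Qed.

Lemma colt_cons k x (t : k.-tuple R) :
  colt [tuple of x :: t] = col_mx (x%:M : 'cV[R]_1) (colt t).
Proof.
apply/matrixP => i j; rewrite ord1 mxE; case: (@split_ordP 1 k i) => {}i ->.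
  apply: etrans _ (esym (@col_mxEu R 1 k 1 _ _ i 0)).
  rewrite ord1 mxE eqxx mulr1n.
  have -> : lshift k (0 : 'I_1) = ord0 :> 'I_k.+1 by exact: val_inj.
  by rewrite tnth0.
apply: etrans _ (esym (@col_mxEd R 1 k 1 _ _ i 0)).
by rewrite mxE rshift1 tnthS.
Qed.

Lemma measurable_bil m n dT (T : measurableType dT) (u : T -> 'cV[R]_m)
    (X : T -> 'M[R]_(m, n)) (v : T -> 'cV[R]_n) :
  measurable_fun [set: T] u -> measurable_fun [set: T] X ->
  measurable_fun [set: T] v -> measurable_fun [set: T] (fun x => bil (u x) (X x) (v x)).
Proof.
move=> mu mX mv; apply: measurable_fun_coord; apply: measurable_mulmx => //.
by apply: measurable_mulmx => //; exact: measurable_trmx.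
Qed.

Definition gauss_lin k (Q : 'M[R]_k) (p y : 'cV[R]_k) : R :=
  expR (- (bil y Q y + 2 * bil y 1%:M p)).

Lemma measurable_gauss_lin k dT (T : measurableType dT) (Q : T -> 'M[R]_k)
    (p y : T -> 'cV[R]_k) :
  measurable_fun [set: T] Q -> measurable_fun [set: T] p ->
  measurable_fun [set: T] y ->
  measurable_fun [set: T] (fun x => gauss_lin (Q x) (p x) (y x)).
Proof.
move=> mQ mp my; apply: measurableT_comp => //; apply: measurableT_comp => //.
apply: measurable_funD; first exact: measurable_bil.
by apply: measurable_funM => //; exact: measurable_bil.
Qed.

(** Induction on [k]: integrating the first variable over the line leaves a Gaussian whose matrix is
    the Schur complement [C] and whose linear term is the residual [p1]. *)
Lemma integral_gauss k (Q : 'M[R]_k) (p : 'cV[R]_k) : posdef Q ->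
  (\int[leb R k]_v (gauss_lin Q p (colt v))%:E)%E =
  (Num.sqrt pi ^+ k / Num.sqrt (\det Q) * expR (bil p (invmx Q) p))%:E.
Proof.
have mg j (Q' : 'M[R]_j) p' : measurable_fun [set: j.-tuple R]
    (fun v => (gauss_lin Q' p' (colt v))%:E).
  by apply/measurable_EFinP; apply: measurable_gauss_lin => //; exact: measurable_colt.
have g0 j (Q' : 'M[R]_j) p' v : (0 <= (gauss_lin Q' p' v)%:E)%E.
  by rewrite lee_fin expR_ge0.
elim: k Q p => [|k IH] Q p.
  move=> _; rewrite integral_leb0// /gauss_lin !(flatmx0 p) !(flatmx0 (colt _)).
  by rewrite !bil0l det_mx00 sqrtr1 mulr0 addr0 oppr0 expR0 expr0 invr1 !mulr1.
case/(@posdefP _ k) => q s C q0 Cp.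
have [Cu CT] := (posdef_unit Cp, Cp.1).
rewrite (integral_lebS (mg _ _ _))//.
pose p0 : R := @usubmx R 1 k 1 p 0 0; pose p' := @dsubmx R 1 k 1 p.
have -> : p = col_mx (p0%:M : 'cV[R]_1) p'.
  by rewrite -[LHS](@vsubmxK R 1 k 1) [usubmx _]mx11_scalar.
rewrite bil_invmx_schur_lower ?gt_eqF// det_schur_lower ?gt_eqF//.
set p1 := p' - _.
pose h (z : R * k.-tuple R) :=
  (gauss_lin (schur_lower q s C) (col_mx (p0%:M : 'cV[R]_1) p')
    (colt [tuple of z.1 :: z.2]))%:E.
have mh : measurable_fun [set: R * k.-tuple R] h.
  apply: (measurableT_comp (mg _ _ _)); exact: measurable_cons.
rewrite (tonelli_lebesgue (leb R k) mh (fun=> g0 _ _ _ _)).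
pose c : R := Num.sqrt pi / Num.sqrt q * expR (p0 ^+ 2 / q).
have c0 : 0 <= c by rewrite !mulr_ge0 ?invr_ge0 ?sqrtr_ge0 ?expR_ge0.
transitivity (\int[leb R k]_v (c%:E * (gauss_lin C p1 (colt v))%:E))%E.
  apply: eq_integral => v _; set y := colt v.
  (* [e] gathers the factors free of the first variable [x], and [2 * r] is the coefficient of [x].
     The term [r^2 / q] from the line integral cancels the rank-one part of the quadratic form in
     [e]. *)
  pose e := expR (- (bil y (C + q^-1 *: (s *m s^T)) y + 2 * bil y 1%:M p')).
  pose r := bil y 1%:M s + p0.
  have -> : (\int[lebesgue_measure]_x h (x, v) =
      \int[lebesgue_measure]_x (e%:E * (expR (- (q * x ^+ 2 + 2 * r * x)))%:E))%E.
    apply: eq_integral => x _; rewrite -EFinM -expRD; congr (expR _)%:E.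
    rewrite colt_cons /= -/y bil_col_mx1 bil_sym_block (bilC s y (trmx1 _ _)) /r -opprD.
    by congr (- _); ring.
  rewrite ge0_integralZl//; last 2 first.
  - apply/measurable_EFinP; apply: measurableT_comp => //.
    apply: measurableT_comp => //; apply: measurable_funD => //.
    by apply: measurable_funM => //; exact: measurable_funX.
  - by rewrite lee_fin expR_ge0.
  rewrite integral_gauss_line// -!EFinM; congr EFin.
  rewrite /c /gauss_lin /e bilDm bilZm bil_outer (bilC s y (trmx1 _ _)).
  rewrite mulrCA -!mulrA -!expRD; congr (_ * (_ * expR _)).
  by rewrite /p1 /r bilDr -scaleNr bilZr; field; rewrite gt_eqF.
rewrite ge0_integralZl//; last exact: mg.
rewrite IH// -EFinM; congr EFin.
rewrite sqrtrM ?(ltW q0)// invfM expRD exprS (mulrC q^-1) /c.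
ring.
Qed.

End gaussian_integral.

(** * Recursion on the dimension *)

Section wishart_integrals.
Variable R : realType.

Lemma measurable_sym d : measurable [set M : 'M[R]_d | M^T = M].
Proof.
(* The symmetric matrices are the zero set of this sum of squares. *)
pose f (M : 'M[R]_d) := \sum_i \sum_j (M j i - M i j) ^+ 2.
have mf : measurable_fun [set: 'M[R]_d] f.
  apply: measurable_sum => i; apply: measurable_sum => j; apply: measurable_funX.
  by apply: measurable_funB; exact: measurable_fun_coord.
rewrite (_ : [set _ | _] = setT `&` f @^-1` [set 0]); first exact: mf.
rewrite setTI; apply/seteqP; split=> M /= => [MT|/eqP].
  by rewrite /f big1 // => i _; rewrite big1 // => j _; rewrite -{1}MT mxE subrr expr0n.
rewrite /f psumr_eq0 => [/allP fi|i _]; last by apply: sumr_ge0 => j _; exact: sqr_ge0.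
apply/matrixP => i j; rewrite mxE; apply/eqP; rewrite -subr_eq0 -sqrf_eq0.
have := fi i (mem_index_enum i) => /=.
rewrite psumr_eq0 => [/allP/(_ j (mem_index_enum j))//|k _]; exact: sqr_ge0.
Qed.

(** The definition quantifies over uncountably many vectors. The recursive criterion of symmetry,
    positive corner and positive definite Schur complement uses finitely many measurable conditions
    instead. *)
Lemma measurable_posdef d : measurable (@posdef R d).
Proof.
elim: d => [|d IH].
  rewrite (_ : @posdef R 0 = setT)//; apply/seteqP; split=> // M _.
  split; first by rewrite [LHS]thinmx0 [RHS]thinmx0.
  by move=> u; rewrite [u]flatmx0 eqxx.
pose a (M : 'M[R]_(1 + d)) : R := M (lshift d 0) (lshift d 0).
pose sch (M : 'M[R]_(1 + d)) :=
  drsubmx M - (a M)^-1 *: (dlsubmx M *m (dlsubmx M)^T).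
have ma : measurable_fun [set: 'M[R]_(1 + d)] a by exact: measurable_fun_coord.
have msch : measurable_fun [set: 'M[R]_(1 + d)] sch.
  have mdl : measurable_fun [set: 'M[R]_(1 + d)] (@dlsubmx R 1 d 1 d).
    apply: measurable_fun_matrixP => i j; under eq_fun do rewrite !mxE.
    exact: measurable_fun_coord.
  apply: measurable_addmx.
    apply: measurable_fun_matrixP => i j; under eq_fun do rewrite !mxE.
    exact: measurable_fun_coord.
  apply: measurable_oppmx; apply: measurable_scalemx; first exact: measurable_invr.
  by apply: measurable_mulmx => //; exact: measurable_trmx.
rewrite (_ : @posdef R d.+1 = [set M : 'M[R]_(1 + d) | M^T = M] `&`
    ((setT `&` a @^-1` `]0, +oo[) `&` (setT `&` sch @^-1` (@posdef R d)))).
  apply: measurableI; first exact: measurable_sym.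
  by apply: measurableI; [exact: ma|exact: msch].
have lowE (M : 'M[R]_(1 + d)) : M^T = M -> M = schur_lower (a M) (dlsubmx M) (sch M).
  rewrite -{1 2}(submxK M) tr_block_mx => /eq_block_mx[_ urE _ _].
  rewrite /schur_lower /sym_block /sch subrK -[LHS]submxK -urE.
  by rewrite [ulsubmx M]mx11_scalar !mxE.
rewrite !setTI; apply/seteqP; split=> M /=.
  move=> Mp; have MT := Mp.1; split=> //.
  by move: Mp; rewrite {1}(lowE _ MT) => /posdef_schur_lower; rewrite in_itv/= andbT.
move=> [MT []]; rewrite in_itv/= andbT => ? ?.
by rewrite (lowE _ MT); exact/posdef_schur_lower.
Qed.

Definition wishart_fn d (g : R) (M Y : 'M[R]_d) : R :=
  \1_(@posdef R d) Y * (\det Y `^ g * expR (- \tr (Y *m M))).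

(* The exponent makes this [wishart_fn g M] at [S^-1] times the Jacobian
   [|S|^-(d+1)] of the inversion. *)
Definition inv_wishart_fn d (g : R) (M S : 'M[R]_d) : R :=
  \1_(@posdef R d) S * (\det S `^ (- (g + d.+1%:R)) * expR (- \tr (invmx S *m M))).

Lemma wishart_fn_ge0 d g (M Y : 'M[R]_d) : 0 <= wishart_fn g M Y.
Proof. by rewrite !mulr_ge0 ?powR_ge0 ?expR_ge0. Qed.

Lemma inv_wishart_fn_ge0 d g (M Y : 'M[R]_d) : 0 <= inv_wishart_fn g M Y.
Proof. by rewrite !mulr_ge0 ?powR_ge0 ?expR_ge0. Qed.

Lemma measurable_wishart_fn d g (M : 'M[R]_d) :
  measurable_fun [set: 'M[R]_d] (wishart_fn g M).
Proof.
apply: measurable_funM; first by apply: measurable_indic; exact: measurable_posdef.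
apply: measurable_funM.
  by apply: (measurableT_comp (measurable_powR _)); exact: measurable_det.
apply: measurableT_comp => //; apply: measurableT_comp => //.
by apply: measurable_mxtrace; apply: measurable_mulmx => //; exact: measurable_cst.
Qed.

Lemma measurable_inv_wishart_fn d g (M : 'M[R]_d) :
  measurable_fun [set: 'M[R]_d] (inv_wishart_fn g M).
Proof.
apply: measurable_funM; first by apply: measurable_indic; exact: measurable_posdef.
apply: measurable_funM.
  by apply: (measurableT_comp (measurable_powR _)); exact: measurable_det.
apply: measurableT_comp => //; apply: measurableT_comp => //.
by apply: measurable_mxtrace; apply: measurable_mulmx => //; exact: measurable_invmx.
Qed.

(* [Gamma_d(g + (d+1)/2)], in the recursive form produced by the block
   decompositions. *)
Fixpoint mgamma_const d (g : R) : \bar R :=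
  if d is d'.+1 then
    ((Num.sqrt pi ^+ d')%:E * gamma_int g * mgamma_const d' (g + 2^-1))%E
  else 1%E.

Lemma mgamma_const_fin_num d g : 0 < g -> mgamma_const d g \is a fin_num.
Proof.
by elim: d g => //= d IH g g0; rewrite !fin_numM ?gamma_int_fin_num// IH// addr_gt0.
Qed.

Lemma integral_pos_indic (f : R -> R) :
  (\int[lebesgue_measure]_x ((0 < x)%R%:R * f x)%:E =
   \int[lebesgue_measure]_(x in `]0%R, +oo[) (f x)%:E)%E.
Proof.
rewrite [RHS]integral_mkcond; apply: eq_integral => x _.
rewrite patchE mem_setE in_itv/= andbT.
by case: ifP => _; rewrite ?mul1r ?mul0r.
Qed.

Lemma measurable_pos_indic : measurable_fun [set: R] (fun x : R => (0 < x)%R%:R : R).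
Proof.
rewrite (_ : (fun x => _) = \1_(`]0, +oo[%classic : set R)).
  by apply: measurable_indic; exact: measurable_itv.
by apply/funext => x; rewrite indicE mem_setE in_itv/= andbT.
Qed.

(** Once [v] is integrated out, the integrand is a product of a function of the corner and a
    function of the remaining block. *)
Lemma block_recursion d (A : R -> R) (c : R) (h : 'M[R]_d -> R) :
  measurable_fun [set: R] A -> (forall x, 0 <= A x) -> 0 <= c ->
  measurable_fun [set: 'M[R]_d] h -> (forall D, 0 <= h D) ->
  (\int[lebesgue_measure]_a \int[lsym R d]_D (A a * (c * h D))%:E =
   (\int[lebesgue_measure]_a (A a)%:E) * (c%:E * \int[lsym R d]_D (h D)%:E))%E.
Proof.
move=> mA A0 c0 mh h0.
have mhE : measurable_fun [set: 'M[R]_d] (EFin \o h) by exact/measurable_EFinP.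
transitivity (\int[lebesgue_measure]_a
    ((A a)%:E * (c%:E * \int[lsym R d]_D (h D)%:E)))%E.
  apply: eq_integral => a _.
  under eq_integral do rewrite mulrA EFinM.
  rewrite ge0_integralZl//; first by rewrite EFinM muleA.
  - by move=> D _; rewrite lee_fin.
  - by rewrite lee_fin mulr_ge0.
rewrite ge0_integralZr//.
- by apply/measurable_EFinP.
- by move=> a _; rewrite lee_fin.
- rewrite mule_ge0 ?lee_fin//; apply: integral_ge0 => D _; by rewrite lee_fin.
Qed.

(** The normalising factor of a Gaussian with matrix [m *: invmx D], where [x = \det D]. The power
    [2^-1] of [x] is what turns [g] into [g + 2^-1]. *)
Lemma inv_sqrt_powR (m x : R) k : 0 < m -> 0 < x ->
  (Num.sqrt (m ^+ k / x))^-1 = m `^ (- (k%:R / 2)) * x `^ 2^-1.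
Proof.
move=> m0 x0; rewrite -powR12_sqrt; last by rewrite divr_ge0 ?exprn_ge0 ?ltW.
rewrite powRM ?exprn_ge0 ?invr_ge0 ?(ltW m0) ?(ltW x0)//.
have -> : x^-1 `^ 2^-1 = (x `^ 2^-1)^-1.
  by rewrite -[x^-1]powR_inv1 ?(ltW x0)// -powRrM mulN1r powRN.
by rewrite -powR_mulrn ?(ltW m0)// -powRrM invfM invrK powRN.
Qed.

Lemma bil_mxtrace d (p : 'cV[R]_d) D : bil p D p = \tr (D *m (p *m p^T)).
Proof. by rewrite mulmxA mxtrace_mulC trace_mx11 /bil mulmxA. Qed.

(** In [v] the integrand is Gaussian with matrix [m *: invmx D] and linear term [p]. Its integral
    contains [exp(p^T D p / m)], which cancels the rank-one part of the lower right block of [M] and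
    leaves [Q]. *)
Lemma wishart_fn_block d g m p (Q : 'M[R]_d) a D : 0 < m ->
  (\int[leb R d]_v (wishart_fn g (schur_lower m p Q) (schur_upper a (colt v) D))%:E)%E =
  ((0 < a)%R%:R * (a `^ g * expR (- (a * m))) *
   (Num.sqrt pi ^+ d * m `^ (- (d%:R / 2)) * wishart_fn (g + 2^-1) Q D))%:E.
Proof.
move=> m0.
(* Off the positive definite range both sides vanish, through the indicators. *)
have [[a0 Dp]|naD] := pselect (0 < a /\ posdef D); last first.
  rewrite (_ : _ * _ = 0).
    apply: integral0_eq => v _; rewrite /wishart_fn indicE memNset ?mul0r//.
    by move=> /posdef_schur_upper.
  have [a0|a0] := boolP (0 < a); last by rewrite !mul0r.
  rewrite /wishart_fn indicE memNset ?mul0r ?mulr0// => Dp; exact: naD.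
have [[Du DT] dD] := (posdef_unit Dp, Dp.1, posdef_det_gt0 Dp).
pose K := a `^ g * expR (- (a * m)) *
  (\det D `^ g * expR (- \tr (D *m (Q + m^-1 *: (p *m p^T))))).
have K0 : 0 <= K by rewrite !mulr_ge0 ?powR_ge0 ?expR_ge0.
transitivity (\int[leb R d]_v (K%:E * (gauss_lin (m *: invmx D) p (colt v))%:E))%E.
  apply: eq_integral => v _; rewrite -EFinM; congr EFin.
  rewrite /wishart_fn indicE mem_set ?mul1r; last exact/posdef_schur_upper.
  rewrite det_schur_upper// powRM ?ltW// /K /gauss_lin /schur_lower.
  rewrite mxtrace_schur_upper_sym_block bilZm.
  rewrite mulrACA -!mulrA -!expRD; congr (_ * (_ * expR _)).
  by ring.
rewrite ge0_integralZl//; last 2 first.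
- apply/measurable_EFinP; apply: measurable_gauss_lin => //; exact: measurable_colt.
- by move=> v _; rewrite lee_fin expR_ge0.
have mDp : posdef (m *: invmx D) by apply: posdefZ => //; exact: posdef_inv.
rewrite integral_gauss//.
rewrite -EFinM; congr EFin; rewrite a0 mul1r.
rewrite /wishart_fn indicE mem_set// mul1r gt0_powRD//.
rewrite detZ det_inv inv_sqrt_powR//.
rewrite invmxZ ?posdef_unit// invmxK bilZm.
rewrite bil_mxtrace.
rewrite /K mulmxDr mxtraceD -scalemxAr mxtraceZ opprD expRD.
have e : expR (- (m^-1 * \tr (D *m (p *m p^T)))) *
    expR (m^-1 * \tr (D *m (p *m p^T))) = 1.
  by rewrite -expRD addNr expR0.
by rewrite -[RHS]mulr1 -[X in _ = _ * X]e; ring.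
Qed.

(** The trace involves [invmx S], which has the upper shape, so the Gaussian in [v] has matrix
    [m / a^2 *: invmx C] and linear term [p']. The powers of [a] cancel in its exponential, which
    again removes the rank-one part. *)
Lemma inv_wishart_fn_block d g m p (Q : 'M[R]_d) a C : 0 < m ->
  (\int[leb R d]_v (inv_wishart_fn g (schur_lower m p Q) (schur_lower a (colt v) C))%:E)%E =
  ((0 < a)%R%:R * (a `^ (- (g + 2)) * expR (- (m / a))) *
   (Num.sqrt pi ^+ d * m `^ (- (d%:R / 2)) * inv_wishart_fn (g + 2^-1) Q C))%:E.
Proof.
move=> m0.
have [[a0 Cp]|naC] := pselect (0 < a /\ posdef C); last first.
  rewrite (_ : _ * _ = 0).
    apply: integral0_eq => v _; rewrite /inv_wishart_fn indicE memNset ?mul0r//.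
    by move=> /posdef_schur_lower.
  have [a0|a0] := boolP (0 < a); last by rewrite !mul0r.
  rewrite /inv_wishart_fn indicE memNset ?mul0r ?mulr0// => Cp; exact: naC.
have [[Cu CT] dC] := (posdef_unit Cp, Cp.1, posdef_det_gt0 Cp).
have CiT : (invmx C)^T = invmx C by rewrite trmx_inv CT.
have an0 : a != 0 by rewrite gt_eqF.
(* The block matrix has size [d + 1], hence [d.+2] where the dimension [d] has [d.+1]. *)
pose h := - (g + d.+2%:R).
pose K := a `^ h * expR (- (m / a)) *
  (\det C `^ h * expR (- \tr (invmx C *m (Q + m^-1 *: (p *m p^T))))).
have K0 : 0 <= K by rewrite !mulr_ge0 ?powR_ge0 ?expR_ge0.
pose m' := m / a ^+ 2; pose p' := (- a^-1) *: (invmx C *m p).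
have m'0 : 0 < m' by rewrite divr_gt0// exprn_gt0.
transitivity (\int[leb R d]_v (K%:E * (gauss_lin (m' *: invmx C) p' (colt v))%:E))%E.
  apply: eq_integral => v _; rewrite -EFinM; congr EFin.
  rewrite /inv_wishart_fn indicE mem_set ?mul1r; last exact/posdef_schur_lower.
  rewrite det_schur_lower// powRM ?ltW// /K /gauss_lin {2}/schur_lower invmx_schur_lower//.
  rewrite mxtrace_schur_upper_sym_block invmxK -/h.
  have -> : bil (- a^-1 *: (invmx C *m colt v)) C (- a^-1 *: (invmx C *m colt v)) =
      a ^- 2 * bil (colt v) (invmx C) (colt v).
    rewrite bilZl bilZr mulrA mulrNN -expr2 exprVn; congr (_ * _).
    by rewrite /bil trmx_mul CiT mulmxA mulmxKV.
  have -> : bil (- a^-1 *: (invmx C *m colt v)) 1%:M p = bil (colt v) 1%:M p'.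
    rewrite /p' bilZl bilZr; congr (_ * _).
    by rewrite /bil trmx_mul CiT !mulmx1 mulmxA.
  rewrite bilZm mulrACA -!mulrA -!expRD; congr (_ * (_ * expR _)).
  by rewrite /m'; field; rewrite gt_eqF.
rewrite ge0_integralZl//; last 2 first.
- apply/measurable_EFinP; apply: measurable_gauss_lin => //; exact: measurable_colt.
- by move=> v _; rewrite lee_fin expR_ge0.
have mCp : posdef (m' *: invmx C) by apply: posdefZ => //; exact: posdef_inv.
rewrite integral_gauss//.
rewrite -EFinM; congr EFin; rewrite a0 mul1r.
rewrite /inv_wishart_fn indicE mem_set// mul1r.
rewrite detZ det_inv inv_sqrt_powR//.
rewrite invmxZ ?posdef_unit// invmxK bilZm.
have -> : bil p' C p' = a ^- 2 * \tr (invmx C *m (p *m p^T)).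
  rewrite /p' bilZl bilZr mulrA mulrNN -expr2 exprVn; congr (_ * _).
  by rewrite -bil_mxtrace /bil trmx_mul CiT -(mulmxA _ C) mulKVmx.
rewrite /K mulmxDr mxtraceD -scalemxAr mxtraceZ opprD expRD.
have -> : m'^-1 * (a ^- 2 * \tr (invmx C *m (p *m p^T))) =
    m^-1 * \tr (invmx C *m (p *m p^T)).
  by rewrite /m'; field; rewrite !gt_eqF.
have e : expR (- (m^-1 * \tr (invmx C *m (p *m p^T)))) *
    expR (m^-1 * \tr (invmx C *m (p *m p^T))) = 1.
  by rewrite -expRD addNr expR0.
(* The Gaussian contributes [a^d] and [(\det C)^(1/2)]. Added to the exponent [h] these give
   [-(g+2)] for [a] and [-(g + 1/2 + (d+1))] for [\det C], the latter being the same function one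
   dimension lower. *)
have -> : m' `^ (- (d%:R / 2)) = m `^ (- (d%:R / 2)) * a `^ d%:R.
  rewrite /m' powRM ?invr_ge0 ?(ltW m0) ?sqr_ge0//; congr (_ * _).
  by rewrite -powR_invn ?(ltW a0)// -powRrM; congr (_ `^ _); field.
have -> : a `^ (- (g + 2)) = a `^ h * a `^ d%:R.
  by rewrite -gt0_powRD//; congr (_ `^ _); rewrite /h -[d.+2]addn2 natrD; ring.
have -> : \det C `^ (- (g + 2^-1 + d.+1%:R)) = \det C `^ h * \det C `^ 2^-1.
  rewrite -gt0_powRD//; congr (_ `^ _); rewrite /h -[d.+2]addn2 -[d.+1]addn1 !natrD.
  by field.
by rewrite -[RHS]mulr1 -[X in _ = _ * X]e; ring.
Qed.

(** The exponents agree: [(g+1) + d/2] for [m] and [g + 1/2 + (d+1)/2] for [\det Q] both equal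
    [g + (d+2)/2]. The two recursions share this inductive step. *)
Lemma block_value d g m (Q : 'M[R]_d) (I : \bar R) : 0 < m -> 0 < \det Q ->
  I = ((\det Q `^ (- (g + 2^-1 + d.+1%:R / 2)))%:E * mgamma_const d (g + 2^-1))%E ->
  ((m `^ (- (g + 1)))%:E * gamma_int g *
    ((Num.sqrt pi ^+ d * m `^ (- (d%:R / 2)))%:E * I) =
  ((m * \det Q) `^ (- (g + d.+2%:R / 2)))%:E * mgamma_const d.+1 g)%E.
Proof.
move=> m0 Q0 ->; rewrite powRM ?(ltW m0) ?(ltW Q0)//=.
have -> : m `^ (- (g + d.+2%:R / 2)) = m `^ (- (g + 1)) * m `^ (- (d%:R / 2)).
  by rewrite -gt0_powRD//; congr (_ `^ _); rewrite -[d.+2]addn2 natrD; field.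
have -> : - (g + d.+2%:R / 2) = - (g + 2^-1 + d.+1%:R / 2).
  by rewrite -[d.+2]addn2 -[d.+1]addn1 !natrD; field.
rewrite !EFinM.
rewrite -!muleA; congr (_ * _)%E.
rewrite (muleCA (gamma_int g)) (muleCA (gamma_int g)) (muleCA (gamma_int g)).
by rewrite (muleCA (Num.sqrt pi ^+ d)%:E) (muleCA (Num.sqrt pi ^+ d)%:E).
Qed.

(** The identity is in [\bar R], where the constant may be infinite; finiteness enters later through
    [mgamma_const_fin_num]. In dimension 0 the measure is a point mass and the integrand is 1. *)
Lemma integral_wishart_fn d g (M : 'M[R]_d) : posdef M ->
  (\int[lsym R d]_Y (wishart_fn g M Y)%:E)%E =
  ((\det M `^ (- (g + d.+1%:R / 2)))%:E * mgamma_const d g)%E.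
Proof.
elim: d g M => [|d IH] g M.
  move=> Mp; rewrite ge0_integral_lsym; last 2 first.
  - by apply/measurable_EFinP; exact: measurable_wishart_fn.
  - by move=> S; rewrite lee_fin wishart_fn_ge0.
  rewrite -[sym_dim 0]/0%N integral_leb0; last first.
    apply/measurable_EFinP.
    exact: (measurableT_comp (@measurable_wishart_fn 0 g M)
      (@measurable_sym_of_tuple R 0)).
  rewrite /wishart_fn !det_mx00 !powR1 mule1 indicE mem_set; last first.
    split; first by rewrite [LHS]thinmx0 [RHS]thinmx0.
    by move=> u; rewrite [u]flatmx0 eqxx.
  by rewrite /mxtrace big_ord0 oppr0 expR0 !mulr1.
case/(@posdefP _ d) => m p Q m0 Qp.
rewrite (integral_schur_upper (f := fun Y => (wishart_fn g (schur_lower m p Q) Y)%:E));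
  last 2 first.
- by apply/measurable_EFinP; exact: measurable_wishart_fn.
- by move=> S; rewrite lee_fin wishart_fn_ge0.
under eq_integral => a _ do under eq_integral => D _ do rewrite wishart_fn_block//.
rewrite (block_recursion (A := fun a => (0 < a)%R%:R * (a `^ g * expR (- (a * m)))));
  last 5 first.
- apply: measurable_funM; first exact: measurable_pos_indic.
  apply: measurable_funM; first exact: measurable_powR.
  apply: measurableT_comp => //; apply: measurableT_comp => //.
  by apply: measurable_funM => //; exact: measurable_cst.
- by move=> x; rewrite mulr_ge0// mulr_ge0 ?powR_ge0 ?expR_ge0.
- by rewrite mulr_ge0 ?exprn_ge0 ?sqrtr_ge0 ?powR_ge0.
- exact: measurable_wishart_fn.
- exact: wishart_fn_ge0.
rewrite integral_pos_indic integral_gamma_scale// det_schur_lower ?gt_eqF//.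
by rewrite (block_value _ _ (IH _ _ Qp))// posdef_det_gt0.
Qed.

(** The value coincides with that of [integral_wishart_fn], which stands in for the change of
    variables [Y = S^-1]. *)
Lemma integral_inv_wishart_fn d g (M : 'M[R]_d) : posdef M ->
  (\int[lsym R d]_Y (inv_wishart_fn g M Y)%:E)%E =
  ((\det M `^ (- (g + d.+1%:R / 2)))%:E * mgamma_const d g)%E.
Proof.
elim: d g M => [|d IH] g M.
  move=> Mp; rewrite ge0_integral_lsym; last 2 first.
  - by apply/measurable_EFinP; exact: measurable_inv_wishart_fn.
  - by move=> S; rewrite lee_fin inv_wishart_fn_ge0.
  rewrite -[sym_dim 0]/0%N integral_leb0; last first.
    apply/measurable_EFinP.
    exact: (measurableT_comp (@measurable_inv_wishart_fn 0 g M)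
      (@measurable_sym_of_tuple R 0)).
  rewrite /inv_wishart_fn !det_mx00 !powR1 mule1 indicE mem_set; last first.
    split; first by rewrite [LHS]thinmx0 [RHS]thinmx0.
    by move=> u; rewrite [u]flatmx0 eqxx.
  by rewrite /mxtrace big_ord0 oppr0 expR0 !mulr1.
case/(@posdefP _ d) => m p Q m0 Qp.
rewrite (integral_schur_lower (f := fun Y => (inv_wishart_fn g (schur_lower m p Q) Y)%:E));
  last 2 first.
- by apply/measurable_EFinP; exact: measurable_inv_wishart_fn.
- by move=> S; rewrite lee_fin inv_wishart_fn_ge0.
under eq_integral => a _ do under eq_integral => D _ do rewrite inv_wishart_fn_block//.
rewrite (block_recursion
    (A := fun a => (0 < a)%R%:R * (a `^ (- (g + 2)) * expR (- (m / a)))));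
  last 5 first.
- apply: measurable_funM; first exact: measurable_pos_indic.
  exact: measurable_gamma_inv_integrand.
- by move=> x; rewrite mulr_ge0// mulr_ge0 ?powR_ge0 ?expR_ge0.
- by rewrite mulr_ge0 ?exprn_ge0 ?sqrtr_ge0 ?powR_ge0.
- exact: measurable_inv_wishart_fn.
- exact: inv_wishart_fn_ge0.
rewrite integral_pos_indic integral_gamma_inv// det_schur_lower ?gt_eqF//.
by rewrite (block_value _ _ (IH _ _ Qp))// posdef_det_gt0.
Qed.

End wishart_integrals.

(** * Integrals of products of Wishart kernels *)

Section pair_integral.
Variables (R : realType) (d : nat).

Lemma integral_posdef_indic (f : 'M[R]_d -> R) :
  (\int[lsym R d]_(S in @posdef R d) (f S)%:E =
   \int[lsym R d]_S (\1_(@posdef R d) S * f S)%:E)%E.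
Proof.
rewrite integral_mkcond; apply: eq_integral => S _.
by rewrite patchE indicE; case: ifP => _; rewrite ?mul1r ?mul0r.
Qed.

(** This is [integral_wishart_fn] at the identity matrix, of determinant 1. *)
Lemma mgammaE (g : R) :
  mgamma d (g + d.+1%:R / 2) = fine (mgamma_const d g).
Proof.
rewrite /mgamma /Rintegral -/(lsym R d) integral_posdef_indic.
rewrite -[mgamma_const d g]mul1e.
rewrite -[1%E](_ : (\det (1%:M : 'M[R]_d) `^ (- (g + d.+1%:R / 2)))%:E = _);
  last by rewrite det1 powR1.
rewrite -integral_wishart_fn; last exact: posdef1.
congr fine; apply: eq_integral => S _.
by rewrite /wishart_fn /etr addrK mulmx1 linearN /= [expR _ * _]mulrC.
Qed.

(** Integrability travels with the value, so that sums and negative multiples can be integrated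
    termwise when the square is expanded. *)
Definition has_integral (f : 'M[R]_d -> R) (v : R) : Prop :=
  (lsym R d).-integrable (@posdef R d) (EFin \o f) /\
  (\int[lsym R d]_(S in @posdef R d) (f S)%:E)%E = v%:E.

Lemma eq_has_integral f g v : {in @posdef R d, f =1 g} ->
  has_integral f v -> has_integral g v.
Proof.
move=> fg [fi fv]; split.
  apply: eq_integrable fi => //; first exact: measurable_posdef.
  by move=> S Sp; rewrite /= fg.
by rewrite -fv; apply: eq_integral => S Sp; rewrite fg.
Qed.

Lemma has_integralZ f v (c : R) : has_integral f v ->
  has_integral (fun S => c * f S) (c * v).
Proof.
have mp := @measurable_posdef R d.
move=> [fi fv]; split; first exact: (integrableZl mp c fi).
by under eq_integral do rewrite EFinM; rewrite integralZl// fv.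
Qed.

Lemma has_integral0 : has_integral (fun=> 0) 0.
Proof.
split; first exact: integrable0.
by rewrite integral0.
Qed.

Lemma has_integralD f g u v : has_integral f u -> has_integral g v ->
  has_integral (fun S => f S + g S) (u + v).
Proof.
have mp := @measurable_posdef R d.
move=> [fi fu] [gi gv]; split; first exact: (integrableD mp fi gi).
by under eq_integral do rewrite EFinD; rewrite integralD// fu gv.
Qed.

Lemma has_integral_sum (I : finType) (f : I -> 'M[R]_d -> R) (v : I -> R) :
  (forall i, has_integral (f i) (v i)) ->
  has_integral (fun S => \sum_i f i S) (\sum_i v i).
Proof.
move=> fv.
suff Hr r : has_integral (fun S => \sum_(i <- r) f i S) (\sum_(i <- r) v i) by [].
elim: r => [|i r IH].
  by rewrite big_nil; under eq_fun do rewrite big_nil; exact: has_integral0.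
rewrite big_cons; under eq_fun do rewrite big_cons.
exact: has_integralD.
Qed.

Lemma has_integral_inv_wishart_fn g (M : 'M[R]_d) : 0 < g -> posdef M ->
  has_integral (inv_wishart_fn g M)
    (\det M `^ (- (g + d.+1%:R / 2)) * mgamma d (g + d.+1%:R / 2)).
Proof.
move=> g0 Mp.
have mp := @measurable_posdef R d.
have E : (\int[lsym R d]_(S in @posdef R d) (inv_wishart_fn g M S)%:E =
    (\det M `^ (- (g + d.+1%:R / 2)) * mgamma d (g + d.+1%:R / 2))%:E)%E.
  rewrite EFinM mgammaE fineK ?mgamma_const_fin_num// -integral_inv_wishart_fn//.
  rewrite integral_posdef_indic.
  apply: eq_integral => S _; congr EFin; rewrite /inv_wishart_fn mulrA; congr (_ * _).
  by rewrite indicE; case: (_ \in _); rewrite ?mul1r ?mul0r.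
split=> //; apply/integrableP; split.
  by apply/measurable_EFinP; apply: measurable_funTS; exact: measurable_inv_wishart_fn.
under eq_integral do rewrite /= ger0_norm ?inv_wishart_fn_ge0//.
by rewrite E ltry.
Qed.

Lemma sym_dimE : (sym_dim d)%:R = d%:R * d.+1%:R / 2 :> R.
Proof.
have e : (sym_dim d).*2 = (d * d.+1)%N.
  by rewrite /sym_dim -[RHS]odd_double_half oddM /= andbN.
by rewrite -natrM -e -muln2 natrM mulfK// pnatr_eq0.
Qed.

(** The part of the kernel that is free of [S]. With [nu = 1/b + d + 1] one has
    [nu/2 = 1/(2b) + (d+1)/2], and [|2 b S|^(nu/2)] releases [(2b)^(d nu/2)]. *)
Definition kernel_coef (b : R) (X : 'M[R]_d) : R :=
  \det X `^ (2 * b)^-1 /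
  ((2 * b) `^ (d%:R * ((2 * b)^-1 + d.+1%:R / 2)) *
   mgamma d ((2 * b)^-1 + d.+1%:R / 2)).

Lemma wishart_densityE (b : R) (X S : 'M[R]_d) : 0 < b -> posdef S ->
  wishart_density (b^-1 + d%:R + 1) (b *: S) X =
  kernel_coef b X * (\det S `^ (- ((2 * b)^-1 + d.+1%:R / 2)) *
               expR (- \tr (invmx S *m ((2 * b)^-1 *: X)))).
Proof.
move=> b0 Sp; rewrite /wishart_density /kernel_coef.
have bn0 : b != 0 by rewrite gt_eqF.
have nuE : (b^-1 + d%:R + 1) / 2 = (2 * b)^-1 + d.+1%:R / 2.
  by rewrite -[d.+1]addn1 natrD; field.
have b20 : 0 < 2 * b by rewrite mulr_gt0.
rewrite nuE addrK scalerA detZ (@powRM _ (_ ^+ d))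
  ?exprn_ge0 ?(ltW b20) ?ltW ?posdef_det_gt0//.
rewrite -powR_mulrn ?(ltW b20)// -powRrM powRN.
have -> : etr (- (2^-1 *: (invmx (b *: S) *m X))) =
    expR (- \tr (invmx S *m ((2 * b)^-1 *: X))).
  rewrite /etr linearN /=; congr (expR (- \tr _)).
  rewrite invmxZ; last by apply: posdef_unit; exact: posdefZ.
  by rewrite -scalemxAl -scalemxAr scalerA invfM.
rewrite !invfM; ring.
Qed.

(** In the product the exponents of [\det S] add up to [-(g + d + 1)] and the traces combine into
    that of [invmx S *m (2^-1 *: N)], so it is a multiple of [inv_wishart_fn g (2^-1 *: N)]. *)
Lemma has_integral_pair (b1 b2 : R) (X1 X2 : 'M[R]_d) :
  0 < b1 -> 0 < b2 -> posdef X1 -> posdef X2 ->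
  has_integral (fun S => wishart_density (b1^-1 + d%:R + 1) (b1 *: S) X1 *
                         wishart_density (b2^-1 + d%:R + 1) (b2 *: S) X2)
   ((2 ^+ sym_dim d)^-1 *
     (b1 `^ (- d%:R / (2 * b1) - (sym_dim d)%:R) *
      b2 `^ (- d%:R / (2 * b2) - (sym_dim d)%:R) *
      (mgamma d ((2 * b1)^-1 + (2 * b2)^-1 + d.+1%:R / 2) /
       (mgamma d ((2 * b1)^-1 + d.+1%:R / 2) *
        mgamma d ((2 * b2)^-1 + d.+1%:R / 2))) *
      ((\det X1 `^ (2 * b1)^-1 * \det X2 `^ (2 * b2)^-1) /
       \det (b1^-1 *: X1 + b2^-1 *: X2)
         `^ ((2 * b1)^-1 + (2 * b2)^-1 + d.+1%:R / 2)))).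
Proof.
move=> b10 b20 X1p X2p.
have b1n : b1 != 0 by rewrite gt_eqF. have b2n : b2 != 0 by rewrite gt_eqF.
pose g := (2 * b1)^-1 + (2 * b2)^-1.
have g0 : 0 < g by rewrite addr_gt0// invr_gt0 mulr_gt0.
pose N := b1^-1 *: X1 + b2^-1 *: X2.
have Np : posdef N by apply: posdefD; apply: posdefZ => //; rewrite invr_gt0.
have M_E : (2 * b1)^-1 *: X1 + (2 * b2)^-1 *: X2 = 2^-1 *: N.
  by rewrite scalerDr !scalerA -!invfM.
have Mp : posdef (2^-1 *: N) by apply: posdefZ.
have H := has_integralZ (kernel_coef b1 X1 * kernel_coef b2 X2)
  (has_integral_inv_wishart_fn g0 Mp).
set V := (X in has_integral _ X).
suff -> : V = kernel_coef b1 X1 * kernel_coef b2 X2 *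
    (\det (2^-1 *: N) `^ (- (g + d.+1%:R / 2)) * mgamma d (g + d.+1%:R / 2)).
  apply: eq_has_integral H => S; rewrite inE => Sp.
  rewrite !wishart_densityE// /inv_wishart_fn indicE mem_set// mul1r -M_E mulmxDr mxtraceD.
  rewrite [X in expR X]opprD expRD.
  have -> : - (g + d.+1%:R) =
      - ((2 * b1)^-1 + d.+1%:R / 2) + - ((2 * b2)^-1 + d.+1%:R / 2).
    by rewrite /g; field; rewrite ?b1n ?b2n.
  by rewrite gt0_powRD ?posdef_det_gt0//; ring.
rewrite /V -/N -/g detZ (@powRM _ (_ ^+ d)) ?exprn_ge0 ?(ltW (posdef_det_gt0 Np))//.
rewrite (powRN (\det N)).
have -> : (2^-1 ^+ d) `^ (- (g + d.+1%:R / 2)) = 2 `^ (d%:R * (g + d.+1%:R / 2)).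
  rewrite exprVn -powR_invn// -powRrM; congr (_ `^ _); ring.
have bE (b : R) : 0 < b -> b `^ (- d%:R / (2 * b) - (sym_dim d)%:R) =
    (b `^ (d%:R * ((2 * b)^-1 + d.+1%:R / 2)))^-1.
  move=> b0; rewrite -powRN sym_dimE; congr (_ `^ _); field; by rewrite gt_eqF.
rewrite !bE// /kernel_coef !(@powRM _ 2 _ (d%:R * _)) ?(ltW b10) ?(ltW b20)//.
(* The powers of 2 from [\det (2^-1 *: N)] and from the two coefficients have total exponent [d (g +
   (d+1)/2) - d (g + d + 1) = - d (d+1)/2]. *)
have two : (2 ^+ sym_dim d)^-1 = 2 `^ (d%:R * (g + d.+1%:R / 2)) /
    (2 `^ (d%:R * ((2 * b1)^-1 + d.+1%:R / 2)) *
     2 `^ (d%:R * ((2 * b2)^-1 + d.+1%:R / 2))) :> R.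
  rewrite -gt0_powRD// -powRN -gt0_powRD// -powR_invn//; congr (_ `^ _).
  by rewrite sym_dimE /g; field; rewrite ?b1n ?b2n.
rewrite two !invfM; ring.
Qed.

Lemma has_integral_kde n1 n2 (b1 b2 : R) (x1 : 'I_n1 -> 'M[R]_d)
    (x2 : 'I_n2 -> 'M[R]_d) (V : 'I_n1 -> 'I_n2 -> R) :
  (forall i j, has_integral (fun S =>
     wishart_density (b1^-1 + d%:R + 1) (b1 *: S) (x1 i) *
     wishart_density (b2^-1 + d%:R + 1) (b2 *: S) (x2 j)) (V i j)) ->
  has_integral (fun S => wishart_kde b1 x1 S * wishart_kde b2 x2 S)
    ((n1%:R * n2%:R)^-1 * \sum_i \sum_j V i j).
Proof.
move=> KV.
have := has_integralZ (n1%:R * n2%:R)^-1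
  (has_integral_sum (fun i => has_integral_sum (fun j => KV i j))).
apply: eq_has_integral => S _; rewrite /wishart_kde mulrACA invfM.
by rewrite mulr_suml; under [in RHS]eq_bigr do rewrite mulr_sumr.
Qed.

End pair_integral.

(** * Weights of the two samples and expansion of the statistic *)

Lemma group_mean_weights (R : realType) (n : 'I_2 -> nat) (W : 'I_2 -> 'I_2 -> R) :
  (forall l, (0 < n l)%N) ->
  let N : nat := (n 0%R + n 1%R)%N in
  let a (i l : 'I_2) : R := (i == l)%:R - (n l)%:R / N%:R in
  \sum_(i < 2) (n i)%:R * \sum_(l1 < 2) \sum_(l2 < 2)
    a i l1 * a i l2 / ((n l1)%:R * (n l2)%:R) * W l1 l2 =
  (n 0 * n 1)%:R / N%:R *
    ((((n 0)%:R * (n 0)%:R)^-1 * W 0 0 - ((n 0)%:R * (n 1)%:R)^-1 * W 0 1) -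
     (((n 1)%:R * (n 0)%:R)^-1 * W 1 0 - ((n 1)%:R * (n 1)%:R)^-1 * W 1 1)).
Proof.
move=> n_gt0 N a; rewrite !big_ord_recl !big_ord0.
rewrite (_ : lift ord0 ord0 = 1 :> 'I_2) ?[ord0]/(0 : 'I_2); last exact: val_inj.
(* The rows of [a] are [(n 1 / N) (1, -1)] and [(n 0 / N) (-1, 1)], so the sum over [i] of
   [n i * a i l1 * a i l2] is [n 0 * n 1 / N] with sign + if [l1 = l2] and - otherwise. *)
rewrite /a /N /= natrM natrD.
have n0 : (n 0)%:R != 0 :> R by rewrite pnatr_eq0 -lt0n.
have n1 : (n 1)%:R != 0 :> R by rewrite pnatr_eq0 -lt0n.
have n01 : (n 0)%:R + (n 1)%:R != 0 :> R by rewrite -natrD pnatr_eq0 -lt0n addn_gt0 n_gt0.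
field.
by rewrite n0 n1 n01.
Qed.

Theorem proposition1 (R : realType) (disp : measure_display)
    (Omega : measurableType disp) (P : probability Omega R)
    (d : nat) (n : 'I_2 -> nat) (b : 'I_2 -> R)
    (X : forall l : 'I_2, 'I_(n l) -> {RV P >-> 'M[R]_d})
    (f : 'I_2 -> 'M[R]_d -> R)
    (d_gt0 : (0 < d)%N)
    (n_gt0 : forall l, (0 < n l)%N)
    (b_gt0 : forall l, 0 < b l)
    (X_posdef : forall l i w, posdef (X l i w))
    (X_indep : mutually_independent
       (fun p : {l : 'I_2 & 'I_(n l)} => X (tag p) (tagged p)))
    (X_density : forall l i, density_on_posdef (X l i) (f l)) :
  let N : nat := (n 0%R + n 1%R)%N in
  let r : nat := sym_dim d in
  let a (i l : 'I_2) : R := (i == l)%:R - (n l)%:R / N%:R in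
  forall w : Omega,
    test_statistic (b 0) (b 1) (fun i => X 0 i w) (fun i => X 1 i w) =
    ((2 ^+ r)^-1 *
     \sum_(i < 2) (n i)%:R *
       \sum_(l1 < 2) \sum_(l2 < 2)
         a i l1 * a i l2 / ((n l1)%:R * (n l2)%:R) *
         b l1 `^ (- d%:R / (2 * b l1) - r%:R) *
         b l2 `^ (- d%:R / (2 * b l2) - r%:R) *
         (mgamma d ((2 * b l1)^-1 + (2 * b l2)^-1 + d.+1%:R / 2) /
          (mgamma d ((2 * b l1)^-1 + d.+1%:R / 2) *
           mgamma d ((2 * b l2)^-1 + d.+1%:R / 2))) *
         \sum_(i1 < n l1) \sum_(i2 < n l2)
           (\det (X l1 i1 w) `^ (2 * b l1)^-1 *
            \det (X l2 i2 w) `^ (2 * b l2)^-1) /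
           \det ((b l1)^-1 *: X l1 i1 w + (b l2)^-1 *: X l2 i2 w)
             `^ ((2 * b l1)^-1 + (2 * b l2)^-1 + d.+1%:R / 2))%:E.
Proof.
move=> N r a w.
pose x l i := X l i w.
pose B l := b l `^ (- d%:R / (2 * b l) - r%:R).
pose Gm l1 l2 := mgamma d ((2 * b l1)^-1 + (2 * b l2)^-1 + d.+1%:R / 2) /
  (mgamma d ((2 * b l1)^-1 + d.+1%:R / 2) * mgamma d ((2 * b l2)^-1 + d.+1%:R / 2)).
pose D l1 l2 i1 i2 :=
  (\det (x l1 i1) `^ (2 * b l1)^-1 * \det (x l2 i2) `^ (2 * b l2)^-1) /
  \det ((b l1)^-1 *: x l1 i1 + (b l2)^-1 *: x l2 i2)
    `^ ((2 * b l1)^-1 + (2 * b l2)^-1 + d.+1%:R / 2).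
pose W l1 l2 := (2 ^+ r)^-1 *
  (B l1 * B l2 * Gm l1 l2 * \sum_(i1 < n l1) \sum_(i2 < n l2) D l1 l2 i1 i2).
pose k l S := wishart_kde (b l) (x l) S.
have kW l1 l2 : has_integral (fun S => k l1 S * k l2 S)
    (((n l1)%:R * (n l2)%:R)^-1 * W l1 l2).
  rewrite /W mulr_sumr mulr_sumr.
  under eq_bigr do rewrite mulr_sumr mulr_sumr.
  apply: has_integral_kde => i j.
  exact: has_integral_pair (b_gt0 l1) (b_gt0 l2) (X_posdef l1 i w) (X_posdef l2 j w).
have kN l1 l2 : has_integral (fun S => -1 * (k l1 S * k l2 S))
    (-1 * (((n l1)%:R * (n l2)%:R)^-1 * W l1 l2)) by exact: has_integralZ.
have sq := has_integralD (has_integralD (kW 0 0) (kN 0 1))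
                         (has_integralD (kN 1 0) (kW 1 1)).
rewrite /test_statistic -/(lsym R d).
under eq_integral => S _.
  (* The two mixed products are kept apart so that the four terms match the pairs [(l1, l2)] of the
     double sum. *)
  rewrite (_ : (_ - _) ^+ 2 = k 0 S * k 0 S + -1 * (k 0 S * k 1 S) +
    (-1 * (k 1 S * k 0 S) + k 1 S * k 1 S)); last first.
    by rewrite -/(k 0 S) -/(k 1 S); ring.
  over.
rewrite sq.2 -EFinM; congr EFin.
transitivity (\sum_(i < 2) (n i)%:R * \sum_(l1 < 2) \sum_(l2 < 2)
    a i l1 * a i l2 / ((n l1)%:R * (n l2)%:R) * W l1 l2).
  by rewrite group_mean_weights//; congr (_ * _); ring.
rewrite mulr_sumr; apply: eq_bigr => i _; rewrite mulrCA; congr (_ * _).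
rewrite mulr_sumr; apply: eq_bigr => l1 _.
rewrite mulr_sumr; apply: eq_bigr => l2 _.
rewrite /W mulrCA; congr (_ * _).
by rewrite !mulrA.
Qed.
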